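(* Let $X=(X_t)_{t\ge0}$ be an isotropic unimodal pure jump Lévy process on $\mathbb R^n$ with transition densities $p_t$ and Lévy–Khintchine exponent $\psi$, where $\psi(\xi)=\psi(|\xi|)$ for a continuous strictly increasing function $\psi:[0,\infty)\to[0,\infty)$ for which there are $0<\underline\alpha\le\bar\alpha<2$, $\underline c\in(0,1]$ and $\bar C\in[1,\infty)$ with $$\underline c\,\lambda^{\underline\alpha}\psi(\theta)\le\psi(\lambda\theta)\le\bar C\,\lambda^{\bar\alpha}\psi(\theta)\qquad\text{for all }\lambda\ge1,\ \theta>0.$$ Let $(B_t)_{t\ge0}$ be a Brownian motion in $\mathbb R^n$, independent of $X$, running twice as fast as standard Brownian motion, let $Y_t=B_t+X_t$, and let $\tilde p_t$ be the transition density of $Y_t$, so that $\int_{\mathbb R^n}e^{i\xi\cdot y}\tilde p_t(y)\,dy=e^{-t(|\xi|^2+\psi(\xi))}$. Then the heat kernel $\varphi_t(x,y)=\tilde p_t(x-y)$, $t>0$, satisfies: (i) For every $f\in C_c(\mathbb R^n)$ and $x\in\mathbb R^n$, $\lim_{t\to0}\int_{\mathbb R^n}\varphi_t(x,y)f(y)\,dy=f(x)$. (ii) There is $\eta\in(0,1]$ such that for all $R>0$ and $x_1,x_2\in\mathbb R^n$ there is a constant $C=C(R,x_1,x_2)$ with $\varphi_{\eta R}(x_1,y)\le C\varphi_R(x_2,y)$ for all $y\in\mathbb R^n$. Moreover, for every $x\in\mathbb R^n$, $R>0$ and every ball $B_R$ of radius $R$ there is a positive constant $C$ (depending on $x$,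 $R$ and the ball) with $\varphi_R(x,y)\ge C$ for all $y\in B_R$. (iii) There exist $\gamma\ge1$, functions $\xi_1,\xi_2:\mathbb R^n\times(0,\infty)\to(1,\infty)$ with $\xi_i(\cdot,t)$ bounded on every bounded set for each $t$ ($i=1,2$), and a function $\Gamma:(0,\infty)\to(0,\infty)$ such that for every $R>0$, every measurable $f\ge0$ and every $x\in\mathbb R^n$, $$\sup_{0<t<R}\int_{\mathbb R^n}\varphi_t(x,y)f(y)\,dy\le\xi_1(x,R)\,\mathcal M_{\Gamma(R)}f(x)+\xi_2(x,R)\int_{\mathbb R^n}\varphi_{\gamma R}(x,y)f(y)\,dy.$$
   Context: Isotropic unimodal pure jump Lévy process: $X$ is a càdlàg process with $X_0=0$ and stationary independent increments; for $t>0$, $X_t$ has a rotationally invariant density $p_t$ that is radially non-increasing on $\mathbb R^n\setminus\{0\}$; and $$\mathbb E[e^{i\xi\cdot X_t}]=\int_{\mathbb R^n}e^{i\xi\cdot y}p_t(y)\,dy=e^{-t\psi(\xi)},\qquad \psi(\xi)=\int_{\mathbb R^n}(1-\cos(\xi\cdot x))\,\nu(dx),$$ with $\nu$ an isotropic unimodal Lévy measure. The density of $B_t$ is $\hat p_t(x)=(4\pi t)^{-n/2}e^{-|x|^2/(4t)}$, so $\tilde p_t=\hat p_t*p_t$. $\mathcal M_Rf(x)=\sup_{0<s<R}\frac1{|B(x,s)|}\int_{B(x,s)}|f(y)|\,dy$ is the local Hardy–Littlewood maximal function, with Lebesgue measure and Euclidean balls. Known fact used in the paper: under these hypotheses $p_t(x)$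 is comparable, uniformly in $t>0$, $x\ne0$, to $[\psi^{-}(1/t)]^n\wedge\frac{t\,\psi(|x|^{-1})}{|x|^n}$, where $\psi^{-}$ is the inverse of $\psi$ (Bogdan–Grzywny–Ryznar). *)

(* Defs.v *)
From HB Require Import structures.
From mathcomp Require Import all_boot all_order all_algebra.
From mathcomp Require Import all_classical all_reals all_analysis.
From mathcomp Require Import measurable_realfun.
From mathcomp Require Import complex.
Import Order.TTheory GRing.Theory Num.Theory.
Import numFieldNormedType.Exports.

Set Implicit Arguments.
Unset Strict Implicit.
Unset Printing Implicit Defensive.

Local Open Scope classical_set_scope.
Local Open Scope ring_scope.

(* R^n is 'rV[R]_n with the library topology (the library norm on it is the
   sup norm; the Euclidean norm is [enorm] below).  Its Borel sigma-algebra is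
   generated by the coordinates, as the library does for n.-tuple T. *)
Section borel_rV.
Context {R : realType} (n : nat).

Definition rV_coord (i : 'I_n) (x : 'rV[R]_n) : R := x ord0 i.

Let rV_set0 : g_sigma_preimage rV_coord set0.
Proof. exact: sigma_algebra0. Qed.

Let rV_setC A : g_sigma_preimage rV_coord A -> g_sigma_preimage rV_coord (~` A).
Proof. exact: sigma_algebraC. Qed.

Let rV_bigcup (F : (set 'rV[R]_n)^nat) :
  (forall i, g_sigma_preimage rV_coord (F i)) ->
  g_sigma_preimage rV_coord (\bigcup_i (F i)).
Proof. exact: sigma_algebra_bigcup. Qed.

HB.instance Definition _ := @isMeasurable.Build default_measure_display
  'rV[R]_n (g_sigma_preimage rV_coord) rV_set0 rV_setC rV_bigcup.

End borel_rV.

Section lebesgue_rV.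
Context {R : realType}.

Definition rV_cons n (p : R * 'rV[R]_n) : 'rV[R]_n.+1 :=
  row_mx (p.1)%:M (p.2) : 'rV[R]_(1 + n).

Fixpoint lebesgue_rV (n : nat) : set 'rV[R]_n -> \bar R :=
  match n return set 'rV[R]_n -> \bar R with
  | 0%N => \d_(0 : 'rV[R]_0)
  | m.+1 => pushforward (@lebesgue_measure R \x @lebesgue_rV m)%E (@rV_cons m)
  end.

Lemma measurable_coord n (i : 'I_n) :
  measurable_fun [set: 'rV[R]_n] (@rV_coord R n i).
Proof.
move=> _ Y mY; rewrite setTI; apply: sub_sigma_algebra => /=.
rewrite -bigcup_seq/=; exists i => /=; first by rewrite mem_index_enum.
by exists Y => //; rewrite setTI.
Qed.

Lemma measurable_rVP d (T : measurableType d) n (f : T -> 'rV[R]_n) :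
  (forall i, measurable_fun [set: T] (@rV_coord R n i \o f)) ->
  measurable_fun [set: T] f.
Proof.
move=> mf.
suff : g_sigma_preimage (fun i => @rV_coord R n i \o f) `<=` measurable.
  rewrite g_sigma_preimage_comp => prefS _ A mA.
  by apply: prefS; exists A.
apply: smallest_sub; first exact: sigma_algebra_measurable.
case: n => [|n] in f mf *; first by rewrite big_ord0.
rewrite -bigcup_mkord_ord; apply: bigcup_sub => i Ii.
by move=> A [B mB <-]; exact: mf.
Qed.

Lemma rV_cons0 n p : @rV_cons n p ord0 ord0 = p.1.
Proof.
transitivity ((row_mx (p.1)%:M p.2 : 'rV[R]_(1 + n)) ord0 (lshift n ord0)).
  by congr (_ _ _); exact: val_inj.
by rewrite row_mxEl mxE eqxx mulr1n.
Qed.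

Lemma rV_consS n p (j : 'I_n) : @rV_cons n p ord0 (lift ord0 j) = p.2 ord0 j.
Proof.
transitivity ((row_mx (p.1)%:M p.2 : 'rV[R]_(1 + n)) ord0 (rshift 1 j)).
  by congr (_ _ _); exact: val_inj.
by rewrite row_mxEr.
Qed.

Lemma measurable_rV_cons n : measurable_fun [set: R * 'rV[R]_n] (@rV_cons n).
Proof.
apply: measurable_rVP => i; case: (unliftP ord0 i) => [j|] ->.
- rewrite (_ : _ \o _ = @rV_coord R n j \o snd).
    by apply: measurableT_comp; [exact: measurable_coord|exact: measurable_snd].
  by apply/funext => p; exact: rV_consS.
- rewrite (_ : _ \o _ = fst)//.
  by apply/funext => p; exact: rV_cons0.
Qed.

Definition rV_uncons n (x : 'rV[R]_n.+1) : R * 'rV[R]_n :=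
  (x ord0 ord0, \row_j x ord0 (lift ord0 j)).

Lemma rV_consK n : cancel (@rV_cons n) (@rV_uncons n).
Proof.
move=> [a y]; rewrite /rV_uncons rV_cons0; congr pair.
by apply/rowP => j; rewrite mxE rV_consS.
Qed.

Lemma measurable_rV_uncons n : measurable_fun [set: 'rV[R]_n.+1] (@rV_uncons n).
Proof.
apply: measurable_fun_pair; first exact: measurable_coord.
apply: measurable_rVP => j.
rewrite (_ : _ \o _ = @rV_coord R n.+1 (lift ord0 j)).
  exact: measurable_coord.
by apply/funext => x; rewrite /rV_coord /= mxE.
Qed.

Section lebesgue_rV_step.
Variables (n : nat) (mu : {sigma_finite_measure set 'rV[R]_n -> \bar R}).
Local Open Scope ereal_scope.

Let nu : set (R * 'rV[R]_n)%type -> \bar R := @lebesgue_measure R \x mu.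
Let rho : set 'rV[R]_n.+1 -> \bar R := pushforward nu (@rV_cons n).

Let rhoE A : rho A = nu (@rV_cons n @^-1` A).
Proof. by []. Qed.

Let mpre A : measurable A -> measurable (@rV_cons n @^-1` A).
Proof.
by move=> mA; rewrite -[X in measurable X]setTI; exact: measurable_rV_cons.
Qed.

Let rho0 : rho set0 = 0.
Proof. by rewrite rhoE preimage_set0 /nu measure0. Qed.

Let rho_ge0 A : 0 <= rho A.
Proof. by rewrite rhoE /nu measure_ge0. Qed.

Let rho_sigma_additive : semi_sigma_additive rho.
Proof.
move=> F mF tF mUF; rewrite rhoE preimage_bigcup.
apply: (@measure_semi_sigma_additive _ _ _
  [the measure _ _ of @lebesgue_measure R \x mu]).
- by move=> i; exact: mpre.
- apply/trivIsetP => i j _ _ ij; rewrite -preimage_setI.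
  by move/trivIsetP : tF => /(_ _ _ _ _ ij) ->//; rewrite preimage_set0.
- by rewrite -preimage_bigcup; exact: mpre.
Qed.

HB.instance Definition _ :=
  isMeasure.Build _ _ _ rho rho0 rho_ge0 rho_sigma_additive.

Let rho_sigma_finite : sigma_finite setT rho.
Proof.
have /sigma_finiteP[F [FT ndF Foo]] := sigma_finiteT (@lebesgue_measure R).
have /sigma_finiteP[G [GT ndG Goo]] := sigma_finiteT mu.
exists (fun k => @rV_uncons n @^-1` (F k `*` G k)).
  apply/esym; rewrite -subTset => x _.
  have [i _ Fi] : (\bigcup_i F i) (rV_uncons x).1 by rewrite -FT.
  have [j _ Gj] : (\bigcup_i G i) (rV_uncons x).2 by rewrite -GT.
  exists (maxn i j) => //; split.
  - by move: Fi; exact/subsetPset/ndF/leq_maxl.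
  - by move: Gj; exact/subsetPset/ndG/leq_maxr.
move=> k; have [mFk Fkoo] := Foo k; have [mGk Gkoo] := Goo k; split.
  rewrite -[X in measurable X]setTI; apply: measurable_rV_uncons => //.
  exact: measurableX.
rewrite rhoE -comp_preimage (_ : _ \o _ = id); last first.
  by apply/funext => p; exact: rV_consK.
by rewrite preimage_id /nu product_measure1E// lte_mul_pinfty// ge0_fin_numE.
Qed.

HB.instance Definition _ := @Measure_isSigmaFinite.Build _ _ _ rho
  rho_sigma_finite.

Lemma lebesgue_rV_step :
  exists mu' : {sigma_finite_measure set 'rV[R]_n.+1 -> \bar R},
    pushforward (@lebesgue_measure R \x mu) (@rV_cons n) = mu' :> (_ -> _).
Proof. by exists [the {sigma_finite_measure set _ -> \bar R} of rho]. Qed.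

End lebesgue_rV_step.

Lemma lebesgue_rV_measure n :
  exists mu : {sigma_finite_measure set 'rV[R]_n -> \bar R},
    @lebesgue_rV n = mu :> (_ -> _).
Proof.
elim: n => [|n [mu muE]]; last by rewrite /= muE; exact: lebesgue_rV_step.
by exists [the {sigma_finite_measure set _ -> \bar R} of \d_(0 : 'rV[R]_0)].
Qed.

Let lebesgue_rV0 n : @lebesgue_rV n set0 = 0%E.
Proof. by have [mu ->] := lebesgue_rV_measure n; exact: measure0. Qed.

Let lebesgue_rV_ge0 n A : (0 <= @lebesgue_rV n A)%E.
Proof. by have [mu ->] := lebesgue_rV_measure n; exact: measure_ge0. Qed.

Let lebesgue_rV_sigma_additive n : semi_sigma_additive (@lebesgue_rV n).
Proof.
by have [mu ->] := lebesgue_rV_measure n; exact: measure_semi_sigma_additive.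
Qed.

HB.instance Definition _ n := isMeasure.Build _ _ _ (@lebesgue_rV n)
  (lebesgue_rV0 n) (@lebesgue_rV_ge0 n) (@lebesgue_rV_sigma_additive n).

Let lebesgue_rV_sigma_finite n : sigma_finite setT (@lebesgue_rV n).
Proof. by have [mu ->] := lebesgue_rV_measure n; exact: sigma_finiteT. Qed.

HB.instance Definition _ n := @Measure_isSigmaFinite.Build _ _ _
  (@lebesgue_rV n) (lebesgue_rV_sigma_finite n).

Lemma measurable_box n (A : 'I_n -> set R) : (forall i, measurable (A i)) ->
  measurable [set x : 'rV[R]_n | forall i, A i (x ord0 i)].
Proof.
move=> mA.
rewrite (_ : mkset _ = \bigcap_(i in [set: 'I_n]) (@rV_coord R n i @^-1` A i)).
  apply: fin_bigcap_measurable => // i _.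
  by rewrite -[X in measurable X]setTI; exact: measurable_coord.
by apply/seteqP; split => x /= Ax i; [move=> _; exact: Ax|exact: Ax].
Qed.

Lemma lebesgue_rV_box n (A : 'I_n -> set R) : (forall i, measurable (A i)) ->
  lebesgue_rV [set x : 'rV[R]_n | forall i, A i (x ord0 i)] =
  (\prod_(i < n) lebesgue_measure (A i))%E.
Proof.
elim: n A => [|n IHn] A mA.
  by rewrite big_ord0 /= diracE mem_set// => -[].
rewrite big_ord_recl -IHn// -product_measure1E//; last first.
  by apply: (@measurable_box n (fun i => A (lift ord0 i))) => i; exact: mA.
  exact: mA.
rewrite /= /pushforward; congr (product_measure1 _ _ _).
apply/seteqP; split => -[a y] /=.
  move=> Ay; split => [|i]; first by have := Ay ord0; rewrite rV_cons0.
  by have := Ay (lift ord0 i); rewrite rV_consS.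
move=> [Aa Ay] i; case: (unliftP ord0 i) => [j|] ->.
  by rewrite rV_consS; exact: Ay.
by rewrite rV_cons0.
Qed.

End lebesgue_rV.

Section euclidean.
Context {R : realType} {n : nat}.
Implicit Types x y : 'rV[R]_n.

Definition dotv x y : R := \sum_(i < n) x ord0 i * y ord0 i.

Definition enorm x : R := Num.sqrt (dotv x x).

Definition eball x (s : R) : set 'rV[R]_n := [set y | enorm (y - x) < s].

Definition compactly_supported (f : 'rV[R]_n -> R) :=
  compact (closure [set x | f x != 0]).

(* invariance under the whole orthogonal group, reflections included *)
Definition rotation_invariant (f : 'rV[R]_n -> R) :=
  forall Q : 'M[R]_n, Q *m Q^T = 1%:M -> forall x, f (x *m Q) = f x.

(* f itself is unconstrained at the origin *)
Definition radially_nonincreasing (f : 'rV[R]_n -> R) :=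
  forall x, x != 0 -> forall r : R, 1 <= r -> f (r *: x) <= f x.

Definition convolution (f g : 'rV[R]_n -> R) x : R :=
  \int[@lebesgue_rV R n]_z (f (x - z) * g z).

(* heat kernel of the Laplacian: the density of N(0, 2t Id) *)
Definition gauss_kernel (t : R) x : R :=
  (4 * pi * t) `^ (- (n%:R / 2)) * expR (- (enorm x ^+ 2 / (4 * t))).

Definition local_HL_maximal (r : R) (f : 'rV[R]_n -> \bar R) x : \bar R :=
  (ereal_sup [set (lebesgue_rV (eball x s))^-1 *
                  \int[@lebesgue_rV R n]_(y in eball x s) `|f y|
             | s in [set s : R | (0 < s < r)%R]])%E.

Definition levy_measure (nu : {measure set 'rV[R]_n -> \bar R}) :=
  nu [set 0] = 0%E /\
  (\int[nu]_x (Num.min 1 (enorm x ^+ 2))%:E < +oo)%E.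

Definition isotropic_unimodal_measure (nu : {measure set 'rV[R]_n -> \bar R}) :=
  exists f : 'rV[R]_n -> R,
    [/\ forall x, 0 <= f x, measurable_fun setT f,
        rotation_invariant f, radially_nonincreasing f &
        forall A : set 'rV[R]_n, measurable A -> ~ A 0 ->
          nu A = (\int[@lebesgue_rV R n]_(x in A) (f x)%:E)%E].

End euclidean.

Section processes.
Context {R : realType} {n : nat} {d : measure_display}.
Context {Omega : measurableType d} (P : probability Omega R).
Implicit Types (Z : Omega -> 'rV[R]_n) (X B : R -> Omega -> 'rV[R]_n).

(* Processes are indexed by R; only their values at times t >= 0 matter. *)

Definition has_density Z (f : 'rV[R]_n -> R) :=
  [/\ forall x, 0 <= f x, measurable_fun setT f &
      forall A, measurable A ->
        P (Z @^-1` A) = (\int[@lebesgue_rV R n]_(x in A) (f x)%:E)%E].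

(* E[exp(i <xi, Z>)] *)
Definition charfun Z (xi : 'rV[R]_n) : R[i] :=
  Complex (fine 'E_P[fun w => cos (dotv xi (Z w))])
          (fine 'E_P[fun w => sin (dotv xi (Z w))]).

Definition increment X (s t : R) : Omega -> 'rV[R]_n :=
  fun w => X t w - X s w.

Definition independent_increments X :=
  forall (m : nat) (s : nat -> R) (A : nat -> set 'rV[R]_n),
    0 <= s 0%N -> (forall i, (i < m)%N -> s i <= s i.+1) ->
    (forall i, measurable (A i)) ->
    P (\bigcap_(i < m) (increment X (s i) (s i.+1) @^-1` A i)) =
    (\prod_(i < m) P (increment X (s i) (s i.+1) @^-1` A i))%E.

Definition stationary_increments X :=
  forall s t : R, 0 <= s -> 0 <= t -> forall A, measurable A ->
    P (increment X s (s + t) @^-1` A) = P (increment X 0 t @^-1` A).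

Definition cadlag (g : R -> 'rV[R]_n) :=
  (forall t : R, 0 <= t -> g s @[s --> t^'+] --> g t) /\
  (forall t : R, 0 < t -> cvg (g s @[s --> t^'-])).

Definition levy_process X :=
  [/\ forall t : R, 0 <= t -> measurable_fun [set: Omega] (X t),
      {ae P, forall w, X 0 w = 0},
      {ae P, forall w, cadlag (X ^~ w)},
      independent_increments X &
      stationary_increments X].

Definition isotropic_unimodal_pure_jump_levy X
    (p : R -> 'rV[R]_n -> R) (psi : 'rV[R]_n -> R)
    (nu : {measure set 'rV[R]_n -> \bar R}) :=
  [/\ levy_process X,
      forall t : R, 0 < t -> [/\ has_density (X t) (p t),
        rotation_invariant (p t) & radially_nonincreasing (p t)],
      forall (t : R) xi, 0 < t ->
        charfun (X t) xi = (expR (- (t * psi xi)))%:C%C,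
      forall xi, (psi xi)%:E = (\int[nu]_x (1 - cos (dotv xi x))%:E)%E &
      levy_measure nu /\ isotropic_unimodal_measure nu].

(* Brownian motion with generator the Laplacian: B t - B s ~ N(0, 2(t-s) Id) *)
Definition double_speed_brownian_motion B :=
  [/\ forall t : R, 0 <= t -> measurable_fun [set: Omega] (B t),
      {ae P, forall w, B 0 w = 0},
      {ae P, forall w, {within `[0, +oo[, continuous (B ^~ w)}},
      independent_increments B &
      forall s t : R, 0 <= s < t ->
        has_density (increment B s t) (gauss_kernel (t - s))].

Definition process_sigma_algebra X : set (set Omega) :=
  <<s [set E | exists t A, [/\ 0 <= t, measurable A & E = X t @^-1` A]] >>.

Definition independent_processes X B :=
  forall E F, process_sigma_algebra X E -> process_sigma_algebra B F ->
    P (E `&` F) = (P E * P F)%E.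

End processes.

(* Main.v *)
(** Let g_t be the Gaussian kernel, so that Y_t has density q_t = g_t * p_t.  Only
    two properties of p_t matter: it is radially non-increasing, and
    p_{s+t} = p_s * p_t, by independence and stationarity of the increments.
    The Levy-type inequality P(|X_s| >= K) <= 2 P(|X_T| >= K) for s < T and
    unimodality bound P(|X_s| < a) from below, uniformly in 0 < s < T.

    (i) Y_t tends to 0 almost surely, hence in probability, as t -> 0.

    (ii) For t < T one has g_t(z + a - u) <= C g_T(z - u - v) for v bounded;
    integrating against p_t(u) p_{T-t}(v) gives q_t(z + a) <= C' q_T(z).

    (iii) Away from 0, q_t <= C q_{3R} uniformly in t < R.  The part of the
    convolution where the Gaussian increment exceeds rho is treated as in (ii).
    In the other part p_t(w) occurs with |w| >= rho only, and p_t(w) is bounded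
    by an average of p_{3R} over a ball around w: in
    p_{3R}(y) = int p_t(y - v) p_{3R-t}(v) dv one has |y - v| <= |w| for y near w
    and v near rho w / (2 |w|).  Near 0, q_t(z) <= p_t(z/2) + g_t(z/2), which is
    radially non-increasing of mass bounded in t, and a dyadic decomposition
    yields the maximal function. *)

Require Import Defs.
From HB Require Import structures.
From mathcomp Require Import all_boot all_order all_algebra.
From mathcomp Require Import all_classical all_reals all_analysis.
From mathcomp Require Import measurable_realfun.
From mathcomp Require Import ring lra.
Import Order.TTheory GRing.Theory Num.Theory.
Import numFieldNormedType.Exports.

Set Implicit Arguments.
Unset Strict Implicit.
Unset Printing Implicit Defensive.

Local Open Scope classical_set_scope.
Local Open Scope ring_scope.

(** * Euclidean norm and radial functions *)

Section euclidean_norm.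
Context {R : realType} {n : nat}.
Implicit Types x y z : 'rV[R]_n.

Lemma dotvC x y : dotv x y = dotv y x.
Proof. by apply: eq_bigr => i _; rewrite mulrC. Qed.

Lemma dotvDl x y z : dotv (x + y) z = dotv x z + dotv y z.
Proof. by rewrite /dotv -big_split; apply: eq_bigr => i _; rewrite mxE mulrDl. Qed.

Lemma dotvZl (a : R) x y : dotv (a *: x) y = a * dotv x y.
Proof. by rewrite /dotv mulr_sumr; apply: eq_bigr => i _; rewrite mxE mulrA. Qed.

Lemma dotvDr x y z : dotv x (y + z) = dotv x y + dotv x z.
Proof. by rewrite dotvC dotvDl !(dotvC x). Qed.

Lemma dotvZr (a : R) x y : dotv x (a *: y) = a * dotv x y.
Proof. by rewrite dotvC dotvZl dotvC. Qed.

Lemma dotvNl x y : dotv (- x) y = - dotv x y.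
Proof. by rewrite -scaleN1r dotvZl mulN1r. Qed.

Lemma dotvNr x y : dotv x (- y) = - dotv x y.
Proof. by rewrite dotvC dotvNl dotvC. Qed.

Lemma dotvv_ge0 x : 0 <= dotv x x.
Proof. by apply: sumr_ge0 => i _; rewrite -expr2 sqr_ge0. Qed.

Lemma enorm_ge0 x : 0 <= enorm x.
Proof. exact: sqrtr_ge0. Qed.

Lemma sqr_enorm x : enorm x ^+ 2 = dotv x x.
Proof. by rewrite sqr_sqrtr// dotvv_ge0. Qed.

Lemma coord_le_enorm x i : `|x ord0 i| <= enorm x.
Proof.
rewrite -(ler_pXn2r (ltn0Sn 1)) ?nnegrE ?enorm_ge0// sqr_enorm -normrX ger0_norm ?sqr_ge0//.
rewrite /dotv (bigD1 i)//= -expr2 lerDl.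
by apply: sumr_ge0 => j _; rewrite -expr2 sqr_ge0.
Qed.

Lemma enorm0 : enorm (0 : 'rV[R]_n) = 0.
Proof. by rewrite /enorm /dotv big1 ?sqrtr0// => i _; rewrite mxE mul0r. Qed.

Lemma enorm_eq0 x : (enorm x == 0) = (x == 0).
Proof.
apply/eqP/eqP => [x0|->]; last exact: enorm0.
apply/rowP => i; rewrite mxE; apply/eqP; rewrite -normr_le0 -x0.
exact: coord_le_enorm.
Qed.

Lemma enorm_gt0 x : (0 < enorm x) = (x != 0).
Proof. by rewrite lt_def enorm_ge0 andbT enorm_eq0. Qed.

Lemma enormZ (a : R) x : enorm (a *: x) = `|a| * enorm x.
Proof.
by rewrite /enorm dotvZl dotvZr mulrA -expr2 sqrtrM ?sqr_ge0// sqrtr_sqr.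
Qed.

Lemma enormN x : enorm (- x) = enorm x.
Proof. by rewrite -scaleN1r enormZ normrN1 mul1r. Qed.

Lemma enormB x y : enorm (x - y) = enorm (y - x).
Proof. by rewrite -enormN opprB. Qed.

(** Cauchy-Schwarz, from the nonnegative square of [enorm y *: x - enorm x *: y], which expands to
    [2 * (a * b) * (a * b - c)]. *)
Lemma dotv_le x y : dotv x y <= enorm x * enorm y.
Proof.
have [->|x0] := eqVneq x 0.
  by rewrite enorm0 mul0r /dotv big1// => i _; rewrite mxE mul0r.
have [->|y0] := eqVneq y 0.
  by rewrite enorm0 mulr0 /dotv big1// => i _; rewrite mxE mulr0.
have := dotvv_ge0 (enorm y *: x - enorm x *: y).
rewrite !(dotvDl, dotvDr, dotvNl, dotvNr, dotvZl, dotvZr) -!sqr_enorm (dotvC y x).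
have : 0 < enorm x * enorm y by rewrite mulr_gt0 ?enorm_gt0.
set a := enorm x; set b := enorm y; set c := dotv x y => ab.
rewrite (_ : _ + _ = 2 * (a * b) * (a * b - c)); last by ring.
by rewrite pmulr_rge0 ?subr_ge0// mulr_gt0.
Qed.

Lemma ler_enormD x y : enorm (x + y) <= enorm x + enorm y.
Proof.
rewrite -(ler_pXn2r (ltn0Sn 1)) ?nnegrE ?addr_ge0 ?enorm_ge0//.
rewrite sqr_enorm dotvDl !dotvDr (dotvC y x) sqrrD -!sqr_enorm.
have := dotv_le x y; lra.
Qed.

Lemma ler_enormB x y : enorm (x - y) <= enorm x + enorm y.
Proof. by rewrite (le_trans (ler_enormD _ _))// enormN. Qed.

Lemma ler_enorm_dist x y z : enorm (x - z) <= enorm (x - y) + enorm (y - z).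
Proof. by rewrite (le_trans _ (ler_enormD _ _))// subrKA. Qed.

Lemma enorm_le_sup_norm x : enorm x <= n%:R * `|x|.
Proof.
have xi i : `|x ord0 i| <= `|x|.
  by rewrite -[leRHS]/(mx_norm x) mx_normrE (le_bigmax _ (fun ij => `|x ij.1 ij.2|) (ord0, i)).
rewrite -(ler_pXn2r (ltn0Sn 1)) ?nnegrE ?enorm_ge0 ?mulr_ge0//.
rewrite sqr_enorm [leRHS]expr2 -mulrA [leRHS]mulr_natl.
have sumE (a : R) : a *+ n = \sum_(i < n) a by rewrite sumr_const card_ord.
rewrite (sumE (`|x| * (n%:R * `|x|))) {sumE}.
apply: ler_sum => i _; rewrite -expr2 -[leLHS]ger0_norm ?sqr_ge0// normrX expr2.
rewrite ler_pM// (le_trans (xi i))// ler_peMl// ler1n.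
by case: n i {x xi} => // -[].
Qed.

Lemma sup_norm_le_enorm x : `|x| <= enorm x.
Proof.
rewrite -[leLHS]/(mx_norm x) mx_normrE; apply/bigmax_leP; split; first exact: enorm_ge0.
by move=> [i j] _ /=; rewrite ord1 coord_le_enorm.
Qed.

(** The Householder reflection in the hyperplane orthogonal to [v = x - y] works: equal norms give
    [dotv v v = 2 * dotv x v], so it subtracts exactly [v] from [x]. *)
Lemma orthogonal_reflection x y : enorm x = enorm y ->
  exists2 Q : 'M[R]_n, Q *m Q^T = 1%:M & x *m Q = y.
Proof.
move=> xy; have [->|neq] := eqVneq x y.
  by exists 1%:M; rewrite ?trmx1 mulmx1.
pose v := x - y; have v0 : dotv v v != 0.
  by rewrite -sqr_enorm expf_neq0// enorm_eq0 subr_eq0.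
have vv (u w : 'rV[R]_n) : u *m w^T = (dotv u w)%:M.
  apply/matrixP => i j; rewrite !ord1 !mxE eqxx mulr1n.
  by apply: eq_bigr => k _; rewrite mxE.
pose c := 2 / dotv v v.
pose Q := 1%:M - c *: (v^T *m v).
have QT : Q^T = Q by rewrite /Q linearB/= trmx1 linearZ/= trmx_mul trmxK.
exists Q.
  rewrite QT /Q; set N := c *: _.
  have NN : N *m N = N + N.
    rewrite /N -scalemxAl -scalemxAr -mulmxA (mulmxA v) vv mul_scalar_mx.
    rewrite -scalemxAr !scalerA -scalerDl; congr (_ *: _).
    by rewrite /c; field.
  by rewrite mulmxBl mul1mx mulmxBr mulmx1 NN opprB addrK subrK.
rewrite /Q mulmxBr mulmx1 -scalemxAr mulmxA vv mul_scalar_mx scalerA.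
suff -> : c * dotv x v = 1 by rewrite scale1r subKr.
suff e : dotv v v = 2 * dotv x v.
  have xv0 : dotv x v != 0 by apply: contraNneq v0 => xv; rewrite e xv mulr0.
  by rewrite /c e; field.
have := congr1 (fun a => a ^+ 2) xy; rewrite /= !sqr_enorm => e.
rewrite /v !(dotvDl, dotvDr, dotvNl, dotvNr) (dotvC y x) e; ring.
Qed.

(** Rotate [x] onto the ray through [y], then use monotonicity along that ray. The origin stays
    excluded because the value of [f] there is unconstrained. *)
Lemma radially_nonincreasing_enorm (f : 'rV[R]_n -> R) :
  rotation_invariant f -> radially_nonincreasing f ->
  forall x y, x != 0 -> enorm x <= enorm y -> f y <= f x.
Proof.
move=> rotf monof x y x0 xy.
have nx : 0 < enorm x by rewrite enorm_gt0.
have ny : 0 < enorm y by exact: lt_le_trans xy.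
pose x' := (enorm x / enorm y) *: y.
have x'E : enorm x = enorm x'.
  by rewrite enormZ ger0_norm ?divr_ge0 ?enorm_ge0// divfK// gt_eqF.
have [Q QQ xQ] := orthogonal_reflection x'E.
rewrite -(rotf Q QQ x) xQ (_ : y = (enorm y / enorm x) *: x').
  by apply: monof; rewrite -?enorm_gt0 -?x'E// ler_pdivlMr// mul1r.
by rewrite scalerA mulrA divfK ?gt_eqF// divff ?scale1r// gt_eqF.
Qed.

Lemma rotation_invariantN (f : 'rV[R]_n -> R) x :
  rotation_invariant f -> f (- x) = f x.
Proof.
move=> rotf; have [|Q QQ <-] := @orthogonal_reflection x (- x); last exact: rotf.
by rewrite enormN.
Qed.

End euclidean_norm.

(** * Invariance of Lebesgue measure *)

Section reflection_invariance.
Context {R : realType}.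
Local Notation leb := (@lebesgue_measure R).
Local Open Scope ereal_scope.

(** By uniqueness of Lebesgue measure it suffices to compare half-open intervals; a reflection
    preserves their length and only exchanges the closed and the open end. *)
Lemma lebesgue_measure_reflect (c : R) (A : set R) : measurable A ->
  pushforward leb ((fun x => (c - x)%R) : R -> measurableTypeR R) A = leb A.
Proof.
pose f : measurableTypeR R -> measurableTypeR R := fun x => (c - x)%R.
have mf : measurable_fun setT f.
  by apply: measurable_funB => //; exact: measurable_cst.
pose m := measure_function_pushforward__canonical__measure_function_Measure leb mf.
move=> mA; apply/esym.
refine (@lebesgue_measure_unique R m _ A mA) => //= _ [[a b]] _ <-.
rewrite /pushforward/=.
rewrite (_ : _ @^-1` _ = `[(c - b)%R, (c - a)%R[%classic); last first.
  by apply/seteqP; split => x /=; rewrite !in_itv/= /f => /andP[? ?]; apply/andP; split; lra.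
rewrite !lebesgue_measure_itv/= !lte_fin ltrD2l ltrN2.
by case: ifPn => // _; rewrite -!EFinB; congr EFin; ring.
Qed.

Lemma ge0_integral_reflect1 (c : R) (f : R -> \bar R) :
  measurable_fun setT f -> (forall x, 0 <= f x) ->
  \int[leb]_x f (c - x)%R = \int[leb]_x f x.
Proof.
move=> mf f0.
pose g : measurableTypeR R -> measurableTypeR R := fun x => (c - x)%R.
have mg : measurable_fun setT g.
  by apply: measurable_funB => //; exact: measurable_cst.
pose m := measure_function_pushforward__canonical__measure_function_Measure leb mg.
transitivity (\int[m]_x f x).
  by rewrite /= ge0_integral_pushforward.
refine (@eq_measure_integral _ _ _ setT leb m f _) => A mA _.
exact: (lebesgue_measure_reflect c mA).
Qed.

Lemma ge0_integral_lebesgue_rVS n (f : 'rV[R]_n.+1 -> \bar R) :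
  measurable_fun setT f -> (forall x, 0 <= f x) ->
  \int[@lebesgue_rV R n.+1]_x f x =
  \int[leb]_a \int[@lebesgue_rV R n]_y f (rV_cons (a, y)).
Proof.
move=> mf f0.
rewrite -[LHS]/(\int[pushforward (leb \x @lebesgue_rV R n) (@rV_cons R n)]_x f x).
rewrite ge0_integral_pushforward//; last exact: measurable_rV_cons.
rewrite preimage_setT fubini_tonelli1//; last by move=> p; exact: f0.
by apply: measurableT_comp => //; exact: measurable_rV_cons.
Qed.

Lemma measurable_rV_reflect n (c : 'rV[R]_n) :
  measurable_fun [set: 'rV[R]_n] (fun x => (c - x)%R).
Proof.
apply: measurable_rVP => i.
rewrite (_ : _ \o _ = (fun x => (c ord0 i - rV_coord i x)%R)); last first.
  by apply/funext => x; rewrite /rV_coord/= !mxE.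
by apply: measurable_funB; [exact: measurable_cst|exact: measurable_coord].
Qed.

(** Induction on the dimension: Tonelli splits off the first coordinate, and a reflection acts on
    each coordinate separately. *)
Lemma ge0_integral_reflect n (c : 'rV[R]_n) (f : 'rV[R]_n -> \bar R) :
  measurable_fun setT f -> (forall x, 0 <= f x) ->
  \int[@lebesgue_rV R n]_x f (c - x)%R = \int[@lebesgue_rV R n]_x f x.
Proof.
elim: n c f => [|n IHn] c f mf f0.
  by apply: eq_integral => x _; congr f; apply/rowP => -[].
have mfc : measurable_fun setT (fun p : R * 'rV[R]_n => f (rV_cons p)).
  by apply: measurableT_comp => //; exact: measurable_rV_cons.
rewrite !ge0_integral_lebesgue_rVS//; last first.
  by apply: (measurableT_comp mf); exact: measurable_rV_reflect.
pose c0 := c ord0 ord0; pose c' := \row_j c ord0 (lift ord0 j).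
have consB a y : (c - rV_cons (a, y))%R = rV_cons ((c0 - a)%R, (c' - y)%R).
  apply/rowP => i; rewrite [LHS]mxE [X in (_ + X)%R = _]mxE.
  case: (unliftP ord0 i) => [j|] ->.
    by rewrite !rV_consS !mxE.
  by rewrite !rV_cons0.
under eq_integral do under eq_integral do rewrite consB.
transitivity (\int[leb]_a \int[@lebesgue_rV R n]_y f (rV_cons ((c0 - a)%R, y))).
  apply: eq_integral => a _.
  apply: (IHn c' (fun y => f (rV_cons ((c0 - a)%R, y)))) => //.
  exact: (measurableT_comp mfc (measurable_pair1 _)).
apply: (@ge0_integral_reflect1 c0 (fun a => \int[@lebesgue_rV R n]_y f (rV_cons (a, y)))).
  by have := measurable_fun_fubini_tonelli_F (m2 := @lebesgue_rV R n) _ mfc (fun=> f0 _).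
by move=> a; exact: integral_ge0.
Qed.

(** A translation is the composite of two reflections. *)
Lemma ge0_integral_translate n (c : 'rV[R]_n) (f : 'rV[R]_n -> \bar R) :
  measurable_fun setT f -> (forall x, 0 <= f x) ->
  \int[@lebesgue_rV R n]_x f (x + c)%R = \int[@lebesgue_rV R n]_x f x.
Proof.
move=> mf f0; rewrite -(ge0_integral_reflect 0 mf f0).
rewrite -[RHS](ge0_integral_reflect (- c)).
- by apply: eq_integral => x _; congr f; rewrite sub0r opprB opprK.
- by apply: (measurableT_comp mf); exact: measurable_rV_reflect.
- by [].
Qed.

End reflection_invariance.

(** * Densities and measurability *)

Section integral_with_density.
Local Open Scope ereal_scope.
Context d (T : measurableType d) (R : realType).
Implicit Types mu m : {measure set T -> \bar R}.

Lemma ge0_le_integralT mu (f g : T -> \bar R) :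
  (forall x, 0 <= f x) -> (forall x, f x <= g x) ->
  \int[mu]_x f x <= \int[mu]_x g x.
Proof.
move=> f0 fg; rewrite !ge0_integralTE//; last by move=> x; exact: le_trans (fg x).
by apply: ereal_sup_le => _ [h hf <-]; exists h => // x; exact: le_trans (fg x).
Qed.

Import HBNNSimple.

(** Extends the defining property of a density from sets to nonnegative functions: linearity for
    simple functions, then monotone convergence on both sides. *)
Lemma ge0_integral_with_density mu m (f : T -> R) (F : T -> \bar R) :
  (forall x, (0 <= f x)%R) -> measurable_fun setT f ->
  (forall A, measurable A -> m A = \int[mu]_(x in A) (f x)%:E) ->
  measurable_fun setT F -> (forall x, 0 <= F x) ->
  \int[m]_x F x = \int[mu]_x ((f x)%:E * F x).
Proof.
move=> f0 mf mE mF F0.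
pose h := nnsfun_approx measurableT mF.
have hF x : EFin \o h ^~ x @ \oo --> F x.
  by apply: cvg_nnsfun_approx => // y _; exact: F0.
have h_nd x : {homo h ^~ x : k l / (k <= l)%N >-> (k <= l)%R}.
  by move=> k l kl; exact/lefP/nd_nnsfun_approx.
have simple k : \int[m]_x (h k x)%:E = \int[mu]_x ((f x)%:E * (h k x)%:E).
  rewrite integralT_nnsfun sintegralE.
  under [RHS]eq_integral do rewrite -EFinM (fimfunE (h k)) mulr_fsumr -fsumEFin//.
  rewrite ge0_integral_fsum//; last 2 first.
    by move=> r; apply/measurable_EFinP; apply: measurable_funM => //; exact: measurable_funM.
    by move=> r x _; rewrite 2!EFinM mule_ge0 ?nnfun_muleindic_ge0// lee_fin.
  apply: eq_fsbigr => r /set_mem[y _ hy]; rewrite mE//.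
  rewrite integral_mkcond -ge0_integralZl//; last 3 first.
    by apply/(measurable_restrictT _ _).1 => //; exact/measurable_EFinP/measurable_funTS.
    by move=> x _; rewrite patchE; case: ifPn => // _; rewrite lee_fin.
    by rewrite lee_fin -hy.
  apply: eq_integral => x _; rewrite patchE indicE.
  by case: (_ \in _); rewrite ?mulr1 ?mulr0 ?mule0// -EFinM mulrC.
transitivity (limn (fun k => \int[m]_x (h k x)%:E)).
  rewrite -monotone_convergence//.
  - by apply: eq_integral => x _; apply/esym/cvg_lim => //; exact: hF.
  - by move=> k; exact/measurable_EFinP.
  - by move=> k x _; rewrite lee_fin.
  - by move=> x _ k l kl; rewrite lee_fin h_nd.
under eq_fun do rewrite simple.
rewrite -monotone_convergence//.
- apply: eq_integral => x _; apply/cvg_lim => //.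
  by apply: cvgeZl => //; exact: hF.
- by move=> k; apply: emeasurable_funM; exact/measurable_EFinP.
- by move=> k x _; rewrite -EFinM lee_fin mulr_ge0.
- by move=> x _ k l kl; rewrite -!EFinM lee_fin ler_wpM2l// h_nd.
Qed.

End integral_with_density.

Section measurability.
Context {R : realType} {n : nat}.
Local Notation V := 'rV[R]_n.

Lemma measurable_rV_add : measurable_fun [set: V * V] (fun p => p.1 + p.2).
Proof.
apply: measurable_rVP => i.
rewrite (_ : _ \o _ = (fun p => rV_coord i p.1 + rV_coord i p.2)); last first.
  by apply/funext => p; rewrite /rV_coord/= mxE.
apply: measurable_funD.
  exact: (measurableT_comp (measurable_coord i) (@measurable_fst _ _ V V)).
exact: (measurableT_comp (measurable_coord i) (@measurable_snd _ _ V V)).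
Qed.

Lemma measurable_rV_opp : measurable_fun [set: V] (fun x => - x).
Proof.
have := @measurable_rV_reflect R n 0.
by under eq_fun do rewrite sub0r.
Qed.

Lemma measurable_rV_sub : measurable_fun [set: V * V] (fun p => p.1 - p.2).
Proof.
rewrite (_ : (fun p => _) =
  (fun p : V * V => p.1 + p.2) \o (fun p : V * V => (p.1, - p.2)))//.
apply: measurableT_comp; first exact: measurable_rV_add.
apply: measurable_fun_pair; first exact: measurable_fst.
exact: (measurableT_comp measurable_rV_opp (@measurable_snd _ _ V V)).
Qed.

Lemma measurable_rV_translate (c : V) : measurable_fun [set: V] (fun x => x + c).
Proof.
have := measurableT_comp (@measurable_rV_reflect R n c) measurable_rV_opp.
by rewrite (_ : _ \o _ = (fun x => x + c))//; apply/funext => x /=; rewrite opprK addrC.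
Qed.

Lemma measurable_enorm : measurable_fun [set: V] (@enorm R n).
Proof.
rewrite (_ : @enorm R n = Num.sqrt \o (fun x => \sum_(i < n) rV_coord i x * rV_coord i x))//.
apply: measurableT_comp.
  by apply: continuous_measurable_fun; exact: sqrt_continuous.
apply: measurable_sum => i; apply: measurable_funM; exact: (measurable_coord i).
Qed.

Lemma measurable_enorm_ball (c : V) (A : set R) : measurable A ->
  measurable [set x : V | A (enorm (x - c))].
Proof.
move=> mA; rewrite -[X in measurable X]setTI.
exact: (measurableT_comp measurable_enorm (measurable_rV_translate (- c))).
Qed.

Lemma measurable_set1_rV (x : V) : measurable [set x].
Proof.
rewrite (_ : [set x] = [set y : V | [set 0] (enorm (y - x))]).
  exact: measurable_enorm_ball.
apply/seteqP; split => y /=; first by move=> ->; rewrite subrr enorm0.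
by move/eqP; rewrite enorm_eq0 subr_eq0 => /eqP.
Qed.

Lemma measurable_eball (c : V) r : measurable (eball c r).
Proof.
rewrite (_ : eball c r = [set x : V | `]-oo, r[%classic (enorm (x - c))]).
  exact: measurable_enorm_ball.
by apply/seteqP; split => x /=; rewrite in_itv.
Qed.

Lemma measurable_gauss t : measurable_fun [set: V] (gauss_kernel t).
Proof.
apply: measurable_funM => //; apply: measurableT_comp => //.
apply: measurable_funN; apply: measurable_funM => //.
by apply: measurable_funX; exact: measurable_enorm.
Qed.

End measurability.

(** * Volumes of Euclidean balls, by comparison with cubes *)

Section volumes.
Context {R : realType} {n : nat}.
Local Notation V := 'rV[R]_n.
Local Notation mu := (@lebesgue_rV R n).
Implicit Types x c : V.

Lemma lebesgue_rV_cube c (r : R) : 0 <= r ->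
  mu [set x : V | forall i, `[c ord0 i - r, c ord0 i + r]%classic (x ord0 i)] =
  ((2 * r) ^+ n)%:E.
Proof.
move=> r0; rewrite (lebesgue_rV_box (A := fun i => `[c ord0 i - r, c ord0 i + r]%classic))//.
rewrite (eq_bigr (fun=> (2 * r)%:E)); last first.
  move=> i _; rewrite lebesgue_measure_itv/= lte_fin.
  case: ifPn => [_|]; first by rewrite -EFinB; congr EFin; ring.
  by rewrite -leNgt => ?; congr EFin; lra.
by rewrite prodEFin prodr_const card_ord.
Qed.

Lemma eball_volume_le c (r : R) : 0 <= r -> (mu (eball c r) <= ((2 * r) ^+ n)%:E)%E.
Proof.
move=> r0; rewrite -(lebesgue_rV_cube c r0); apply: le_measure; rewrite ?inE.
- exact: measurable_eball.
- by apply: (measurable_box (A := fun i => `[c ord0 i - r, c ord0 i + r]%classic)).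
- move=> x; rewrite /eball/= => xr i; rewrite in_itv/=.
  have := le_lt_trans (coord_le_enorm (x - c) i) xr.
  by rewrite !mxE ltr_norml => /andP[? ?]; apply/andP; split; lra.
Qed.

Lemma eball_volume_ge c (r : R) : 0 < r -> (0 < n)%N ->
  (((r / n%:R) ^+ n)%:E <= mu (eball c r))%E.
Proof.
move=> r0 n0; have n1 : 0 < n%:R :> R by rewrite ltr0n.
(* A cube of half-side [r / n / 2] fits inside the ball, because the Euclidean norm is at most [n]
   times the sup norm. *)
have s0 : 0 <= r / n%:R / 2 by rewrite !divr_ge0// ltW.
have -> : r / n%:R = 2 * (r / n%:R / 2) by field; rewrite gt_eqF.
rewrite -(lebesgue_rV_cube c s0); apply: le_measure; rewrite ?inE.
- exact: (measurable_box (A := fun i => `[c ord0 i - r / n%:R / 2, c ord0 i + r / n%:R / 2]%classic)).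
- exact: measurable_eball.
move=> x /= xc; rewrite /eball/=; apply: le_lt_trans (enorm_le_sup_norm _) _.
apply: (@le_lt_trans _ _ (n%:R * (r / n%:R / 2))).
  rewrite ler_pM2l// -[leLHS]/(mx_norm (x - c)) mx_normrE; apply/bigmax_leP; split => //.
  move=> [i j] _ /=; rewrite ord1 !mxE ler_norml.
  by have := xc j; rewrite in_itv/= => /andP[? ?]; apply/andP; split; lra.
by rewrite mulrA [_ * (r / _)]mulrC divfK ?gt_eqF// ltr_pdivrMr// ltr_pMr// ltr1n.
Qed.

Lemma eball_volume_gt0 c (r : R) : 0 < r -> (0 < n)%N -> (0 < mu (eball c r))%E.
Proof.
move=> r0 n0; apply: lt_le_trans (eball_volume_ge c r0 n0).
by rewrite lte_fin exprn_gt0// divr_gt0// ltr0n.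
Qed.

Lemma eball_volume_fin c (r : R) : 0 <= r -> mu (eball c r) \is a fin_num.
Proof.
by move=> r0; rewrite ge0_fin_numE// (le_lt_trans (eball_volume_le c r0))// ltry.
Qed.

Lemma lebesgue_rV_set1 c : (0 < n)%N -> mu [set c] = 0%E.
Proof.
move=> n0; have := lebesgue_rV_cube c (lexx 0); rewrite mulr0 expr0n gtn_eqF//= => mu0; apply: etrans mu0.
congr (mu _); apply/seteqP; split => x /=; first by move=> -> i; rewrite in_itv/= addr0 subr0 !lexx.
by move=> xc; apply/rowP => i; have := xc i; rewrite in_itv/= addr0 subr0 -eq_le => /eqP.
Qed.

End volumes.

(** * Expectations with respect to a probability density *)

Section density_expectation.
Context {R : realType} {n : nat}.
Local Notation V := 'rV[R]_n.
Local Notation mu := (@lebesgue_rV R n).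
Implicit Types (q r s : V -> R) (F G : V -> \bar R) (A : set V).
Local Open Scope ereal_scope.

Definition is_density q := [/\ forall x, (0 <= q x)%R, measurable_fun setT q &
  \int[mu]_x (q x)%:E = 1].

(** The expectation of [F] at a random vector with density [q]. *)
Definition dexp q F := \int[mu]_x ((q x)%:E * F x).

Definition radial_decreasing q :=
  forall x y, x != 0%R -> (enorm x <= enorm y -> q y <= q x)%R.

(** [s] is the convolution of [q] and [r], in weak form: a density is determined by its law only
    almost everywhere, so no pointwise identity is available. *)
Definition density_of_sum q r s := forall F, measurable_fun setT F ->
  (forall x, 0 <= F x) ->
  dexp s F = dexp r (fun v => dexp q (fun u => F (u + v)%R)).

Section one_density.
Variables (q : V -> R) (dq : is_density q).

Let q0 x : 0 <= (q x)%:E. Proof. by case: dq => q0 _ _; rewrite lee_fin. Qed.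
Let mq : measurable_fun setT (EFin \o q).
Proof. by case: dq => _ ? _; exact/measurable_EFinP. Qed.

Lemma dexp_ge0 F : (forall x, 0 <= F x) -> 0 <= dexp q F.
Proof. by move=> F0; apply: integral_ge0 => x _; rewrite mule_ge0. Qed.

Lemma le_dexp F G : (forall x, 0 <= F x) -> (forall x, F x <= G x) ->
  dexp q F <= dexp q G.
Proof.
move=> F0 FG; apply: ge0_le_integralT => x; first by rewrite mule_ge0.
by rewrite lee_wpmul2l.
Qed.

Lemma dexpZr F k : measurable_fun setT F -> (forall x, 0 <= F x) -> 0 <= k ->
  dexp q (fun x => F x * k) = dexp q F * k.
Proof.
move=> mF F0 k0; rewrite /dexp; under eq_integral do rewrite muleA.
by rewrite ge0_integralZr//; first [exact: emeasurable_funM|move=> x _; exact: mule_ge0].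
Qed.

Lemma dexpD F G : measurable_fun setT F -> (forall x, 0 <= F x) ->
  measurable_fun setT G -> (forall x, 0 <= G x) ->
  dexp q (fun x => F x + G x) = dexp q F + dexp q G.
Proof.
move=> mF F0 mG G0; rewrite /dexp; under eq_integral do rewrite ge0_muleDr//.
by rewrite ge0_integralD//; first [exact: emeasurable_funM|move=> x _; exact: mule_ge0].
Qed.

Lemma dexp_cst k : 0 <= k -> dexp q (fun=> k) = k.
Proof.
move=> k0; rewrite /dexp ge0_integralZr//.
by case: dq => _ _ ->; rewrite mul1e.
Qed.

Lemma dexp_indic A : dexp q (fun x => (\1_A x)%:E) = \int[mu]_(x in A) (q x)%:E.
Proof.
rewrite [RHS]integral_mkcond; apply: eq_integral => x _.
by rewrite patchE indicE; case: (x \in A); rewrite ?mule1 ?mule0.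
Qed.

Lemma dexp_indic_le1 A : dexp q (fun x => (\1_A x)%:E) <= 1.
Proof.
rewrite -[leRHS](dexp_cst (k := 1))//; by apply: le_dexp => x; rewrite lee_fin.
Qed.

Lemma dexp_shift F v : measurable_fun setT F -> (forall x, 0 <= F x) ->
  dexp q (fun u => F (u + v)%R) = \int[mu]_y ((q (y - v)%R)%:E * F y).
Proof.
move=> mF F0.
rewrite -[RHS](ge0_integral_translate v); first by apply: eq_integral => x _; rewrite addrK.
- apply: emeasurable_funM => //.
  exact: (measurableT_comp mq (measurable_rV_translate (- v)%R)).
- by move=> x; rewrite mule_ge0.
Qed.

Lemma dexpN F : (forall x, q (- x)%R = q x) -> measurable_fun setT F ->
  (forall x, 0 <= F x) -> dexp q (fun u => F (- u)%R) = dexp q F.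
Proof.
move=> qN mF F0; rewrite -[RHS](ge0_integral_reflect 0%R).
- by apply: eq_integral => x _; rewrite sub0r qN.
- exact: emeasurable_funM.
- by move=> x; rewrite mule_ge0.
Qed.

Lemma measurable_dexp (H : V * V -> \bar R) : measurable_fun setT H ->
  (forall x, 0 <= H x) -> measurable_fun setT (fun v => dexp q (fun u => H (v, u))).
Proof.
move=> mH H0.
have := @measurable_fun_fubini_tonelli_F _ _ V V R mu
  (fun z : V * V => (q z.2)%:E * H z).
apply=> [|z]; last by rewrite mule_ge0.
by apply: emeasurable_funM => //; exact: (measurableT_comp mq (@measurable_snd _ _ V V)).
Qed.

Lemma measurable_dexp_add F : measurable_fun setT F -> (forall x, 0 <= F x) ->
  measurable_fun setT (fun v => dexp q (fun u => F (u + v)%R)).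
Proof.
move=> mF F0; under eq_fun do under eq_fun do rewrite addrC.
apply: (measurable_dexp (H := fun z => F (z.1 + z.2)%R)) => //.
exact: (measurableT_comp mF measurable_rV_add).
Qed.

Lemma dexp_indic_ge A (a : R) : measurable A -> (0 <= a)%R ->
  (forall x, A x -> (a <= q x)%R) -> a%:E * mu A <= dexp q (fun x => (\1_A x)%:E).
Proof.
move=> mA a0 aq; have <- : \int[mu]_x (\1_A x)%:E = mu A by rewrite integral_indic// setIT.
rewrite -ge0_integralZl_EFin//; last exact/measurable_EFinP/measurable_indic.
apply: ge0_le_integralT => x; first by rewrite mule_ge0 ?q0// lee_fin.
rewrite indicE; case: (boolP (x \in A)) => [/set_mem Ax|]; last by rewrite !mule0.
by rewrite !mule1 lee_fin aq.
Qed.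

Lemma dexp_indic_le A (a : R) : measurable A -> (0 <= a)%R ->
  (forall x, A x -> (q x <= a)%R) -> dexp q (fun x => (\1_A x)%:E) <= a%:E * mu A.
Proof.
move=> mA a0 aq; have <- : \int[mu]_x (\1_A x)%:E = mu A by rewrite integral_indic// setIT.
rewrite -ge0_integralZl_EFin//; last exact/measurable_EFinP/measurable_indic.
apply: ge0_le_integralT => x; first by rewrite mule_ge0 ?q0// lee_fin.
rewrite indicE; case: (boolP (x \in A)) => [/set_mem Ax|]; last by rewrite !mule0.
by rewrite !mule1 lee_fin aq.
Qed.

Lemma dexp_indicC A : measurable A ->
  dexp q (fun x => (\1_A x)%:E) + dexp q (fun x => (\1_(~` A) x)%:E) = 1.
Proof.
have mI B : measurable B -> measurable_fun setT (fun x : V => (\1_B x : R)%:E).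
  by move=> mB; exact/measurable_EFinP/measurable_indic.
move=> mA; rewrite -(dexpD (mI _ mA) _ (mI _ (measurableC mA)))//.
rewrite -[RHS](dexp_cst (k := 1))//; congr (dexp _ _); apply/funext => x.
by rewrite -EFinD !indicE in_setC; case: (x \in A); rewrite /= ?addr0 ?add0r.
Qed.

(** The balls of radius [k.+1] exhaust the space, so by monotone convergence their masses tend to
    1. *)
Lemma density_tight (e : R) : (0 < e)%R ->
  exists2 K, (0 < K)%R & dexp q (fun x => (\1_(~` eball 0 K) x)%:E) <= e%:E.
Proof.
move=> e0; pose B k : set V := eball 0 k.+1%:R.
have mB k : measurable (B k) by exact: measurable_eball.
have ndB : nondecreasing_seq B.
  move=> k l kl; apply/subsetPset => x; rewrite /B /eball/= => /lt_le_trans; apply.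
  by rewrite ler_nat.
have UB : \bigcup_k B k = setT.
  rewrite -subTset => x _; exists (Num.truncn (enorm x)) => //.
  by rewrite /B /eball/= subr0 truncnS_gt.
have mqB k : measurable_fun (B k) (EFin \o q) by exact: measurable_funTS.
have := ge0_nondecreasing_set_cvg_integral (mu := mu) ndB mB mqB (fun _ x _ => q0 x).
rewrite UB /=; case: (dq) => _ _ -> Bcvg.
have [k Bk] : exists k, (1 - e)%:E < \int[mu]_(x in B k) (q x)%:E.
  apply: contrapT => /forallNP H; have : 1 <= (1 - e)%:E.
    rewrite -(cvg_lim _ Bcvg)//; apply: lime_le; first by apply/cvg_ex; exists 1.
    by apply: nearW => k; rewrite leNgt; apply/negP; exact: H.
  by rewrite lee_fin; lra.
exists k.+1%:R => //.
rewrite -dexp_indic in Bk; have := dexp_indicC (mB k).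
have : 0 <= dexp q (fun x => (\1_(~` B k) x)%:E).
  by apply: dexp_ge0 => x; rewrite lee_fin.
move: Bk; rewrite -/(B k); case: (dexp q _) => [a| |]//; case: (dexp q _) => [b| |]//=.
rewrite !lte_fin !lee_fin => h _ [ab]; lra.
Qed.

End one_density.

End density_expectation.

(** * Convolution semigroups of radial densities *)

Section radial_densities.
Context {R : realType} {n : nat}.
Local Notation V := 'rV[R]_n.
Local Notation mu := (@lebesgue_rV R n).
Implicit Types (q r : V -> R) (F G : V -> \bar R) (A : set V) (p : R -> V -> R).
Local Open Scope ereal_scope.

Lemma measurable_fun_EFin_indic A : measurable A ->
  measurable_fun setT (fun x : V => (\1_A x : R)%:E).
Proof. by move=> mA; exact/measurable_EFinP/measurable_indic. Qed.

Lemma mem_eballC0 (a : R) (x : V) : (x \in ~` eball 0 a) = (a <= enorm x)%R.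
Proof.
by rewrite in_setC leNgt -[in RHS](subr0 x); congr negb; apply/idP/idP => [/set_mem|?]; rewrite ?inE.
Qed.

Lemma le_dexp_indic q A B : is_density q -> A `<=` B ->
  dexp q (fun x => (\1_A x)%:E) <= dexp q (fun x => (\1_B x)%:E).
Proof.
move=> dq AB; apply: le_dexp => // x; rewrite lee_fin// !indicE.
by case: (boolP (x \in A)) => // /set_mem/AB/mem_set ->.
Qed.

Lemma dexp_ge_indic q A F k : is_density q -> measurable A -> 0 <= k ->
  (forall x, 0 <= F x) -> (forall x, A x -> k <= F x) ->
  dexp q (fun x => (\1_A x)%:E) * k <= dexp q F.
Proof.
move=> dq mA k0 F0 kF; rewrite -dexpZr//; last exact: measurable_fun_EFin_indic.
apply: le_dexp => // x; first by rewrite mule_ge0// lee_fin.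
rewrite indicE; case: (boolP (x \in A)) => [/set_mem Ax|_].
  by rewrite mul1e kF.
by rewrite mul0e F0.
Qed.

Lemma exists_enorm_eq (a : R) : (0 < n)%N -> (0 <= a)%R -> exists x : V, enorm x = a.
Proof.
move=> n0 a0; pose v : V := const_mx 1%R.
have v0 : enorm v != 0%R.
  rewrite enorm_eq0; apply/eqP => /rowP /(_ (Ordinal n0)).
  by rewrite !mxE => /eqP; rewrite oner_eq0.
exists ((a / enorm v) *: v); rewrite enormZ ger0_norm ?divfK//.
by rewrite divr_ge0// enorm_ge0.
Qed.

Lemma eball0_shift_inside (c : V) (a : R) x : enorm c = a -> eball c a x ->
  x != 0%R /\ (enorm x < 2 * a)%R.
Proof.
rewrite /eball/= => ca xc; split.
  by apply: contraTneq xc => ->; rewrite sub0r enormN ca ltxx.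
have := ler_enormD (x - c) c; rewrite subrK ca; lra.
Qed.

Lemma density_half_ball q : is_density q -> exists2 K, (0 < K)%R &
  (2^-1)%:E <= dexp q (fun x => (\1_(eball 0 K) x)%:E).
Proof.
move=> dq; have [|K K0 tailK] := @density_tight _ _ q dq 2^-1; first by rewrite invr_gt0.
exists K => //; have := dexp_indicC dq (measurable_eball 0%R K); move: tailK.
have : 0 <= dexp q (fun x => (\1_(eball 0 K) x)%:E).
  by apply: dexp_ge0 => // x; rewrite lee_fin.
case: (dexp _ (fun x => (\1_(~` _) x)%:E)) => [b| |]//; case: (dexp _ _) => [c| |]//=.
by rewrite !lee_fin -EFinD => _ h [?]; lra.
Qed.

(** For [e] of norm [a / 2], such a [q] is at most [q e] on the annulus between radii [a] and [K],
    and at least [q e] on a ball inside the punctured ball of radius [a / 2]. Comparing volumes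
    gives a constant independent of [q]. *)
Lemma small_ball_comparison (a K : R) : (0 < n)%N -> (0 < a)%R -> (0 < K)%R ->
  exists2 C : R, (0 < C)%R & forall q, is_density q -> radial_decreasing q ->
    dexp q (fun x => (\1_(eball 0 K) x)%:E) <=
    C%:E * dexp q (fun x => (\1_(eball 0 a) x)%:E).
Proof.
move=> n0 a0 K0.
(* The ball of radius [a / 4] around [c] has the origin, where [q] is not controlled, on its
   boundary and lies within distance [a / 2] of it. *)
have [c ca] : exists c : V, enorm c = (a / 4)%R.
  by apply: exists_enorm_eq => //; rewrite divr_ge0// ltW.
pose e := (2 *: c)%R.
have ea : enorm e = (a / 2)%R by rewrite enormZ ger0_norm// ca; field.
have e0 : e != 0%R by rewrite -enorm_gt0 ea divr_gt0.
pose dl := ((a / 4 / n%:R) ^+ n)%R; pose Du := ((2 * K) ^+ n)%R.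
have dl0 : (0 < dl)%R by rewrite exprn_gt0// !divr_gt0// ltr0n.
have Du0 : (0 < Du)%R by rewrite exprn_gt0// mulr_gt0.
exists (1 + Du / dl)%R; first by rewrite addr_gt0// divr_gt0.
move=> q dq rq; have qe0 : (0 <= q e)%R by case: dq.
have lower : (q e * dl)%:E <= dexp q (fun x => (\1_(eball 0 a) x)%:E).
  apply: (@le_trans _ _ (dexp q (fun x => (\1_(eball c (a / 4)) x)%:E))).
    rewrite EFinM.
    apply: (@le_trans _ _ ((q e)%:E * mu (eball c (a / 4)%R))).
      by rewrite lee_wpmul2l// ?lee_fin//; apply: eball_volume_ge => //; rewrite divr_gt0.
    apply: dexp_indic_ge => //; first exact: measurable_eball.
    move=> x /(eball0_shift_inside ca)[x0 xa]; apply: rq => //.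
    by rewrite ea; lra.
  apply: le_dexp_indic => // x /(eball0_shift_inside ca)[x0 xa].
  by rewrite /eball/= subr0; lra.
pose A : set V := eball 0 K `\` eball 0 a.
have mA : measurable A by apply: measurableD; exact: measurable_eball.
have upper : dexp q (fun x => (\1_A x)%:E) <= (q e * Du)%:E.
  apply: (@le_trans _ _ ((q e)%:E * mu A)).
    apply: dexp_indic_le => // x [_ /negP]; rewrite -leNgt subr0 => ax.
    by apply: rq => //; rewrite ea; lra.
  rewrite EFinM lee_wpmul2l// ?lee_fin//; apply: le_trans (eball_volume_le 0 (ltW K0)).
  by apply: le_measure; rewrite ?inE//; [exact: measurable_eball|move=> x []].
rewrite EFinD ge0_muleDl ?lee_fin//; last by rewrite divr_ge0 ?ltW.
rewrite mul1e; apply: (@le_trans _ _ (dexp q (fun x => (\1_(eball 0 a) x)%:E) +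
    dexp q (fun x => (\1_A x)%:E))).
  rewrite -(dexpD dq (measurable_fun_EFin_indic (measurable_eball 0%R a)) _
    (measurable_fun_EFin_indic mA))//.
  apply: le_dexp => // x; rewrite -EFinD lee_fin// !indicE.
  case: (boolP (x \in eball 0 K)) => //= [/set_mem xK|_]; last by rewrite addr_ge0.
  have [xa|xa] := boolP (x \in eball 0 a); first by rewrite lerDl.
  by rewrite add0r mem_set//; split => // /mem_set; exact/negP.
apply: leeD => //; apply: (le_trans upper).
rewrite (_ : (q e * Du)%:E = (Du / dl)%:E * (q e * dl)%:E).
  by rewrite lee_wpmul2l// lee_fin divr_ge0 ?ltW.
by rewrite -EFinM; congr EFin; field; rewrite gt_eqF.
Qed.

(* Either u + v or u - v is at least as long as u. *)
Lemma tail_of_sum q r (s : V -> R) (K : R) : is_density q -> is_density r ->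
  (forall x, r (- x)%R = r x) -> density_of_sum q r s ->
  dexp q (fun x => (\1_(~` eball 0 K) x)%:E) <=
  dexp s (fun x => (\1_(~` eball 0 K) x)%:E) *+ 2.
Proof.
move=> dq dr rN sE; pose A : set V := ~` eball 0 K.
have mA : measurable A by apply: measurableC; exact: measurable_eball.
have mI := measurable_fun_EFin_indic mA.
pose H v := dexp q (fun u => (\1_A (u + v)%R : R)%:E).
have mH : measurable_fun setT H.
  by apply: (measurable_dexp_add dq mI) => x; rewrite lee_fin.
have H0 v : 0 <= H v by apply: dexp_ge0 => // x; rewrite lee_fin.
(* Since [r] is even, one of the two copies may be rewritten with [- v] in place of [v]. *)
rewrite sE// -/A -/(H _) mule2n -{2}(dexpN dr rN mH H0) -(dexpD dr mH H0); last 2 first.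
  exact: (measurableT_comp mH measurable_rV_opp).
  by move=> v; exact: H0.
rewrite -[leLHS](dexp_cst dr); last by apply: dexp_ge0 => // x; rewrite lee_fin.
apply: le_dexp => // [_|v]; first by apply: dexp_ge0 => // x; rewrite lee_fin.
have mIv w : measurable_fun setT (fun u : V => (\1_A (u + w)%R : R)%:E).
  exact: (measurableT_comp mI (measurable_rV_translate w)).
rewrite /H -dexpD//; apply: le_dexp => // u; rewrite -?EFinD lee_fin// !indicE.
rewrite !mem_eballC0; have [Ku|_] := leP K (enorm u); last by rewrite addr_ge0.
have : (K <= enorm (u + v))%R || (K <= enorm (u - v))%R.
  case: (leP K (enorm (u + v))) => //= uv; rewrite leNgt; apply/negP => uv'.
  have := ler_enormD (u + v) (u - v).
  rewrite addrACA subrr addr0 -mulr2n -scaler_nat enormZ ger0_norm//; lra.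
by case/orP => ->; rewrite ?lerDl ?lerDr.
Qed.

Definition radial_semigroup p := forall t, (0 < t)%R ->
  [/\ is_density (p t), radial_decreasing (p t), forall x, p t (- x)%R = p t x &
      forall s, (0 < s)%R -> density_of_sum (p s) (p t) (p (s + t)%R)].

(** A radius [K] with tail at most 1/4 at time [T] has tail at most 1/2 at every earlier time, by
    [tail_of_sum]. The remaining mass 1/2 in the ball of radius [K] is passed on to the ball of
    radius [a] by [small_ball_comparison]. *)
Lemma small_ball_uniform p (T a : R) : (0 < n)%N -> radial_semigroup p ->
  (0 < T)%R -> (0 < a)%R -> exists2 c : R, (0 < c)%R &
    forall s, (0 < s < T)%R -> c%:E <= dexp (p s) (fun x => (\1_(eball 0 a) x)%:E).
Proof.
move=> n0 Hp T0 a0; have [dT _ _ _] := Hp _ T0.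
have [K K0 tailK] : exists2 K, (0 < K)%R &
    dexp (p T) (fun x => (\1_(~` eball 0 K) x)%:E) <= (4^-1)%:E.
  by apply: (density_tight dT); rewrite invr_gt0.
have [C C0 HC] := small_ball_comparison n0 a0 K0.
exists (2^-1 / C)%R; first by rewrite divr_gt0// invr_gt0.
move=> s /andP[s0 sT]; have [ds rs _ _] := Hp _ s0.
have Ts : (0 < T - s)%R by rewrite subr_gt0.
have [dTs _ evenTs /(_ _ s0)] := Hp _ Ts; rewrite (addrC s) subrK => sE.
have := tail_of_sum K ds dTs evenTs sE => tails.
have mK : measurable (eball (0 : V) K) by exact: measurable_eball.
have := dexp_indicC ds mK.
have tails2 : dexp (p s) (fun x => (\1_(~` eball 0 K) x)%:E) <= (2^-1)%:E.
  apply: (le_trans tails); rewrite mule2n; apply: (le_trans (leeD tailK tailK)).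
  by rewrite -EFinD lee_fin; lra.
have := HC _ ds rs.
have : 0 <= dexp (p s) (fun x => (\1_(~` eball 0 K) x)%:E).
  by apply: dexp_ge0 => // x; rewrite lee_fin.
have := dexp_indic_le1 ds (eball 0 a).
have : 0 <= dexp (p s) (fun x => (\1_(eball 0 a) x)%:E).
  by apply: dexp_ge0 => // x; rewrite lee_fin.
move: tails2.
case: (dexp _ (fun x => (\1_(~` _) x)%:E)) => [tl| |]//.
case: (dexp _ (fun x => (\1_(eball 0 a) x)%:E)) => [sm| |]//.
case: (dexp _ (fun x => (\1_(eball 0 K) x)%:E)) => [lg| |]//.
rewrite -EFinM -EFinD !lee_fin => tl2 _ _ _ lgsm [lgtl].
rewrite ler_pdivrMr// mulrC; lra.
Qed.

(** A density cannot vanish off the origin, a null set; a positive value at some [x] then bounds [q]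
    from below at all nonzero points no farther out than [x]. *)
Lemma density_positive_near0 q : (0 < n)%N -> is_density q -> radial_decreasing q ->
  exists a c : R, [/\ (0 < a)%R, (0 < c)%R &
    forall x, x != 0%R -> (enorm x <= a)%R -> (c <= q x)%R].
Proof.
move=> n0 [q0 mq q1] rq.
have [x [x0 qx]] : exists x, x != 0%R /\ (0 < q x)%R.
  apply: contrapT => /forallNP H.
  have : \int[mu]_x (q x)%:E = 0.
    rewrite (@ge0_negligible_integral _ _ _ mu setT [set 0%R])//; last 4 first.
    - exact: measurable_set1_rV.
    - exact/measurable_EFinP.
    - by move=> x _; rewrite lee_fin.
    - exact: lebesgue_rV_set1.
    rewrite (eq_integral (cst 0)) ?integral_cst_fin ?integral0// => x /set_mem[_ /= /eqP x0].
    have := H x; case: (ltgtP (q x) 0%R) (q0 x) => // [qx|->//] _ nH.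
    by exfalso; apply: nH.
  by rewrite q1 => /eqP; rewrite onee_eq0.
exists (enorm x), (q x); split => //; first by rewrite enorm_gt0.
by move=> y y0 yx; exact: rq.
Qed.

(** Uniformity in [t] comes from splitting [T - t] as [(T - S) + (S - t)]: the density at the fixed
    time [T - S] is bounded below near 0, and the increment over [S - t] stays within [rho / 8] with
    probability bounded below. *)
Lemma off_center_ball p (S T : R) : (0 < n)%N -> radial_semigroup p ->
  (0 < S)%R -> (S < T)%R -> exists rho b : R, [/\ (0 < rho)%R, (0 < b)%R &
    forall t v, (0 < t < S)%R -> enorm v = (rho / 2)%R ->
      b%:E <= dexp (p (T - t)%R) (fun x => (\1_(eball v (rho / 4)) x)%:E)].
Proof.
move=> n0 Hp S0 ST; have TS0 : (0 < T - S)%R by rewrite subr_gt0.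
have [dq rq _ _] := Hp _ TS0.
have [rho [c [rho0 c0 qc]]] := density_positive_near0 n0 dq rq.
have rho8 : (0 < rho / 8)%R by rewrite divr_gt0.
have [c1 c10 Hc1] := small_ball_uniform n0 Hp S0 rho8.
pose dl := ((rho / 8 / n%:R) ^+ n)%R.
have dl0 : (0 < dl)%R by rewrite exprn_gt0// divr_gt0// ltr0n.
exists rho, (c1 * (c * dl))%R; split => //; first by rewrite !mulr_gt0.
move=> t v /andP[t0 tS] vrho; have St0 : (0 < S - t)%R by rewrite subr_gt0.
have [dr _ _ /(_ _ TS0)] := Hp _ St0.
rewrite (_ : T - S + (S - t) = T - t)%R; last by ring.
move=> ->; [|by apply: measurable_fun_EFin_indic; exact: measurable_eball|by move=> x; rewrite lee_fin].
apply: (@le_trans _ _ (dexp (p (S - t)%R) (fun x => (\1_(eball 0 (rho / 8)) x)%:E) *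
    (c * dl)%:E)).
  rewrite EFinM lee_wpmul2r//; first by rewrite lee_fin mulr_ge0// ltW.
  by apply: Hc1; rewrite St0/= ltrBlDr ltrDl.
apply: dexp_ge_indic => //.
- exact: measurable_eball.
- by rewrite lee_fin mulr_ge0 ?ltW.
- by move=> x; apply: dexp_ge0 => // y; rewrite lee_fin.
move=> x; rewrite /eball/= subr0 => xrho.
apply: (@le_trans _ _ (dexp (p (T - S)%R) (fun u => (\1_(eball v (rho / 8)) u)%:E))).
  apply: (@le_trans _ _ (c%:E * mu (eball v (rho / 8)%R))).
    rewrite EFinM lee_wpmul2l ?lee_fin ?(ltW c0)//; exact: eball_volume_ge.
  apply: dexp_indic_ge => //; [exact: measurable_eball|exact: ltW|].
  move=> u; rewrite /eball/= => uv; apply: qc.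
    by apply: contraTneq uv => ->; rewrite sub0r enormN vrho -leNgt; lra.
  have := ler_enormD (u - v) v; rewrite subrK vrho; lra.
apply: le_dexp => // u; rewrite lee_fin// !indicE.
case: (boolP (u \in _)) => // /set_mem; rewrite /eball/= => uv.
rewrite mem_set//=; have := ler_enormD (u - v) x.
by rewrite addrAC; lra.
Qed.

(* For v in the small ball, y - v stays in the punctured ball of radius |w|. *)
Lemma average_le_of_sum q r (s : V -> R) (rho b : R) (w : V) F :
  is_density q -> radial_decreasing q -> is_density r -> density_of_sum q r s ->
  (0 < rho)%R -> (rho <= enorm w)%R -> (0 <= b)%R ->
  (forall v, enorm v = (rho / 2)%R ->
    b%:E <= dexp r (fun x => (\1_(eball v (rho / 4)) x)%:E)) ->
  measurable_fun setT F -> (forall x, 0 <= F x) ->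
  b%:E * ((q w)%:E * \int[mu]_(y in eball w (rho / 4)) F y) <= dexp s F.
Proof.
move=> dq rq dr sE rho0 rhow b0 Hb mF F0.
have w0 : (0 < enorm w)%R by exact: lt_le_trans rhow.
pose v := ((rho / 2 / enorm w) *: w)%R.
have vE : enorm v = (rho / 2)%R.
  by rewrite enormZ ger0_norm ?divfK ?gt_eqF// divr_ge0 ?ltW// divr_gt0.
have wvE : enorm (w - v) = (enorm w - rho / 2)%R.
  rewrite -{1}[w]scale1r -scalerBl enormZ ger0_norm.
    by rewrite mulrBl mul1r divfK// gt_eqF.
  by rewrite subr_ge0 ler_pdivrMr// mul1r; lra.
have q0 x : (0 <= q x)%R by case: dq.
rewrite sE//; set k := _ * integral _ _ _.
have k0 : 0 <= k by rewrite mule_ge0 ?lee_fin// integral_ge0.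
apply: (@le_trans _ _ (dexp r (fun x => (\1_(eball v (rho / 4)) x)%:E) * k)).
  by rewrite lee_wpmul2r// Hb.
apply: dexp_ge_indic => //; first exact: measurable_eball.
  by move=> x; apply: dexp_ge0.
move=> x; rewrite /eball/= => xv; rewrite (dexp_shift dq)//.
rewrite /k integral_mkcond -ge0_integralZl_EFin//; last 2 first.
- by move=> y _; rewrite patchE; case: ifP.
- apply/(measurable_restrictT _ _).1; first exact: measurable_eball.
  exact: measurable_funTS.
apply: ge0_le_integralT => y; rewrite ?mule_ge0 ?lee_fin// patchE.
  by case: ifP.
case: ifPn => [/set_mem|_]; last by rewrite mule0 mule_ge0 ?lee_fin.
(* Since [v] lies on the segment from 0 to [w], [enorm (w - v)] is [enorm w - rho / 2]. The two
   errors below [rho / 4] then keep [y - x] nonzero and no longer than [w]. *)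
rewrite /eball/= => yw; rewrite lee_wpmul2r// lee_fin; apply: rq.
  apply: contraTneq yw => /eqP; rewrite subr_eq0 => /eqP ->; rewrite -leNgt.
  have := ler_enorm_dist w x v; rewrite wvE (enormB w x); lra.
have := ler_enormD (y - w) (w - v + (v - x)).
have := ler_enormD (w - v) (v - x); rewrite (enormB v x) wvE.
rewrite !addrA !subrK; lra.
Qed.

End radial_densities.

(** * Gaussian kernels *)

Section gaussian_bounds.
Context {R : realType} {n : nat}.
Local Notation V := 'rV[R]_n.
Local Notation g := (@gauss_kernel R n).
Implicit Types x y : V.

Lemma gauss_kernel_gt0 t x : 0 < t -> 0 < g t x.
Proof. by move=> t0; rewrite mulr_gt0 ?expR_gt0// powR_gt0// !mulr_gt0// pi_gt0. Qed.

Lemma gauss_kernel_decr t x y : 0 < t -> enorm x <= enorm y -> g t y <= g t x.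
Proof.
move=> t0 xy; rewrite /gauss_kernel ler_wpM2l ?powR_ge0// ler_expR lerN2.
have t4 : 0 <= (4 * t)^-1 by rewrite invr_ge0 mulr_ge0// ltW.
by rewrite (ler_wpM2r t4)// ler_pXn2r ?nnegrE ?enorm_ge0.
Qed.

Lemma gauss_kernel_le0 t x : 0 < t -> g t x <= g t 0.
Proof. by move=> t0; apply: gauss_kernel_decr => //; rewrite enorm0 enorm_ge0. Qed.

Lemma gauss_kernel_ge t M : 0 < t -> exists2 c : R, 0 < c &
  forall x, enorm x <= M -> c <= g t x.
Proof.
move=> t0; exists ((4 * pi * t) `^ (- (n%:R / 2)) * expR (- (M ^+ 2 / (4 * t)))).
  by rewrite mulr_gt0 ?expR_gt0// powR_gt0// !mulr_gt0// pi_gt0.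
move=> x xM; rewrite /gauss_kernel ler_wpM2l ?powR_ge0// ler_expR lerN2.
have t4 : 0 <= (4 * t)^-1 by rewrite invr_ge0 mulr_ge0// ltW.
rewrite (ler_wpM2r t4)// ler_pXn2r ?nnegrE ?enorm_ge0//.
by apply: le_trans xM; exact: enorm_ge0.
Qed.

(** The larger variance absorbs a bounded displacement: completing the square bounds
    [(enorm x + m) ^+ 2 / (4 * T)] by [enorm x ^+ 2 / (4 * t)] plus a constant, whose exponential
    enters [C] along with the ratio of the prefactors. *)
Lemma gauss_kernel_shift (t T m : R) : 0 < t -> t < T -> exists2 C : R, 0 < C &
  forall x y, enorm (x - y) <= m -> g t x <= C * g T y.
Proof.
move=> t0 tT; have T0 : 0 < T by exact: lt_trans tT.
have Tt : 0 < T - t by rewrite subr_gt0.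
pose a s : R := (4 * pi * s) `^ (- (n%:R / 2)).
have a0 s : 0 < s -> 0 < a s by move=> s0; rewrite powR_gt0// !mulr_gt0// pi_gt0.
exists (a t / a T * expR (m ^+ 2 / (4 * (T - t)))).
  by rewrite mulr_gt0 ?expR_gt0// divr_gt0// a0.
move=> x y xym; rewrite /gauss_kernel -/(a t) -/(a T).
rewrite mulrACA divfK ?gt_eqF ?a0// ler_wpM2l ?(ltW (a0 _ t0))// -expRD ler_expR.
have yx : enorm y <= enorm x + m.
  have := ler_enormD x (y - x); rewrite addrC subrK (enormB y x); lra.
have m0 : 0 <= m by apply: le_trans xym; exact: enorm_ge0.
have y2 : enorm y ^+ 2 <= (enorm x + m) ^+ 2.
  by rewrite ler_pXn2r ?nnegrE ?enorm_ge0// addr_ge0 ?enorm_ge0.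
have sq : (enorm x + m) ^+ 2 / (4 * T) <=
    enorm x ^+ 2 / (4 * t) + m ^+ 2 / (4 * (T - t)).
  have -> : enorm x ^+ 2 / (4 * t) + m ^+ 2 / (4 * (T - t)) =
      (enorm x + m) ^+ 2 / (4 * T) +
      ((T - t) * enorm x - t * m) ^+ 2 / (4 * T * t * (T - t)).
    by field; rewrite !gt_eqF.
  by rewrite lerDl divr_ge0 ?sqr_ge0// !mulr_ge0// ltW.
have : enorm y ^+ 2 / (4 * T) <= (enorm x + m) ^+ 2 / (4 * T).
  have T4 : 0 <= (4 * T)^-1 by rewrite invr_ge0 mulr_ge0// ltW.
  by rewrite (ler_wpM2r T4).
lra.
Qed.

(** Half of the exponent, at least [dlt ^+ 2 / (8 * t)], compensates the prefactor that blows up as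
    [t] tends to 0; the other half dominates the exponent at time [2 * S]. *)
Lemma gauss_kernel_off_origin (S dlt : R) : (0 < n)%N -> 0 < S -> 0 < dlt ->
  exists2 C : R, 0 < C & forall t x, 0 < t < S -> dlt <= enorm x ->
    g t x <= C * g (2 * S) x.
Proof.
move=> n0 S0 d0; pose a : R := n%:R / 2; pose c := pi * dlt ^+ 2 / 2.
have a0 : 0 < a by rewrite divr_gt0// ltr0n.
have c0 : 0 < c by rewrite divr_gt0// mulr_gt0 ?pi_gt0// exprn_gt0.
pose b := (4 * pi * (2 * S)) `^ (- a).
have b0 : 0 < b by rewrite powR_gt0// !mulr_gt0// pi_gt0.
exists (expR (a * ln (a / c)) / b); first by rewrite divr_gt0 ?expR_gt0.
move=> t x /andP[t0 tS] dx; rewrite /gauss_kernel -/a -/b mulrA divfK ?gt_eqF//.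
pose u : R := 4 * pi * t.
have u0 : 0 < u by rewrite !mulr_gt0// pi_gt0.
rewrite -/u /powR gt_eqF// -!expRD ler_expR.
(* Bounds the logarithm of the prefactor by applying [ln z <= z] at [z = c / (a * u)]; [c] was
   chosen so that [c / u] is [dlt ^+ 2 / (8 * t)]. *)
have lnu : - (a * ln u) <= a * ln (a / c) + c / u.
  have lz : a * ln (c / (a * u)) <= c / u.
    rewrite -ler_pdivlMl// (le_trans (ltW (ln_sublinear _)))//.
      by rewrite divr_gt0// mulr_gt0.
    by rewrite invfM; lra.
  have au0 : 0 < a * u by exact: mulr_gt0.
  have e1 : ln (c / (a * u)) = ln c - (ln a + ln u).
    by rewrite ln_div ?posrE// lnM ?posrE.
  have e2 : ln (a / c) = ln a - ln c by rewrite ln_div ?posrE.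
  by move: lz; rewrite e1 e2; lra.
have cu : c / u = dlt ^+ 2 / (8 * t).
  have p0 : pi != 0 :> R by rewrite gt_eqF// pi_gt0.
  by rewrite /c /u; move: (@pi R) p0 => P p0; field; rewrite p0 gt_eqF.
have xd : dlt ^+ 2 / (8 * t) <= enorm x ^+ 2 / (8 * t).
  have t8 : 0 <= (8 * t)^-1 by rewrite invr_ge0 mulr_ge0// ltW.
  by rewrite (ler_wpM2r t8)// ler_pXn2r ?nnegrE ?enorm_ge0// ltW.
have xt : enorm x ^+ 2 / (8 * S) <= enorm x ^+ 2 / (8 * t).
  by rewrite ler_wpM2l ?sqr_ge0// lef_pV2 ?posrE ?mulr_gt0// ler_wpM2l// ltW.
have -> : enorm x ^+ 2 / (4 * (2 * S)) = enorm x ^+ 2 / (8 * S).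
  by congr (_ / _); ring.
have -> : enorm x ^+ 2 / (4 * t) = enorm x ^+ 2 / (8 * t) + enorm x ^+ 2 / (8 * t).
  by field; rewrite gt_eqF.
rewrite mulNr; lra.
Qed.

End gaussian_bounds.

(** * Convolution of a radial semigroup with the Gaussian kernel *)

Section smoothed_semigroup.
Context {R : realType} {n : nat}.
Local Notation V := 'rV[R]_n.
Local Notation mu := (@lebesgue_rV R n).
Local Notation g := (@gauss_kernel R n).
Implicit Types (q r : V -> R) (F : V -> \bar R) (p : R -> V -> R) (x y z : V).
Local Open Scope ereal_scope.

Definition gauss_smoothing t q z := dexp q (fun u => (g t (z - u))%:E).

Lemma measurable_gauss_reflect t z :
  measurable_fun setT (fun u : V => (g t (z - u)%R)%:E).
Proof.
apply/measurable_EFinP.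
exact: (measurableT_comp (measurable_gauss t) (measurable_rV_reflect z)).
Qed.

Lemma gauss_smoothing_ge0 t q z : is_density q -> (0 < t)%R ->
  0 <= gauss_smoothing t q z.
Proof.
by move=> dq t0; apply: dexp_ge0 => // u; rewrite lee_fin ltW// gauss_kernel_gt0.
Qed.

Lemma gauss_smoothing_fin t q z : is_density q -> (0 < t)%R ->
  gauss_smoothing t q z \is a fin_num.
Proof.
move=> dq t0; rewrite ge0_fin_numE ?gauss_smoothing_ge0//.
apply: (@le_lt_trans _ _ (g t 0)%:E); last exact: ltry.
have g00 : 0 <= (g t 0)%:E by rewrite lee_fin ltW// gauss_kernel_gt0.
rewrite -[leRHS](dexp_cst dq g00).
by apply: le_dexp => // u; rewrite lee_fin ?gauss_kernel_le0// ltW// gauss_kernel_gt0.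
Qed.

(** [convolution] is real-valued, the finite part of an integral; boundedness of the Gaussian makes
    that integral finite, so nothing is lost. *)
Lemma convolution_gaussE t q z : is_density q -> (0 < t)%R ->
  (convolution (g t) q z)%:E = gauss_smoothing t q z.
Proof.
move=> dq t0; rewrite -[RHS](fineK (gauss_smoothing_fin z dq t0)).
by congr (_ %:E); congr fine; apply: eq_integral => u _; rewrite -EFinM mulrC.
Qed.

(** The mechanism for bounding the smoothed density from below at a later time: split the jump part
    into summands [u] and [v], and keep only the event that [v] lies in the ball of radius [K]. *)
Lemma gauss_smoothing_ge_of_sum q r (s : V -> R) (h : V -> R) T z (K b C : R) :
  is_density q -> is_density r -> is_density s -> density_of_sum q r s ->
  (0 < T)%R -> (0 <= C)%R -> (forall u, (0 <= h u)%R) ->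
  b%:E <= dexp r (fun x => (\1_(eball 0 K) x)%:E) ->
  (forall u v, (enorm v < K)%R -> (h u <= C * g T (z - (u + v)))%R) ->
  b%:E * dexp q (EFin \o h) <= C%:E * gauss_smoothing T s z.
Proof.
move=> dq dr ds sE T0 C0 h0 bK hC.
have gT0 u : 0 <= (g T u)%:E by rewrite lee_fin ltW// gauss_kernel_gt0.
have mg := measurable_gauss_reflect T z.
rewrite [leRHS]muleC /gauss_smoothing sE//.
pose H v := dexp q (fun u => (g T (z - (u + v)))%:E).
have mH : measurable_fun setT H by exact: (measurable_dexp_add dq mg).
have H0 v : 0 <= H v by exact: dexp_ge0.
rewrite -(dexpZr dr mH)// ?lee_fin//.
apply: (@le_trans _ _ (dexp r (fun x => (\1_(eball 0 K) x)%:E) * dexp q (EFin \o h))).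
  by rewrite lee_wpmul2r//; apply: dexp_ge0 => // u; rewrite lee_fin.
apply: dexp_ge_indic => //; first exact: measurable_eball.
- by apply: dexp_ge0 => // u; rewrite lee_fin.
- by move=> v; rewrite mule_ge0// lee_fin.
move=> v; rewrite /eball/= subr0 => vK; rewrite /H -dexpZr//; last first.
  exact: (measurableT_comp mg (measurable_rV_translate v)).
apply: le_dexp => // u /=; rewrite lee_fin//.
by rewrite mulrC hC.
Qed.

(** The increment over [T - t] lies in some ball of radius [K] with probability at least 1/2, whence
    the factor 2. On that event the Gaussian argument moves by at most [enorm a + K], which
    [gauss_kernel_shift] absorbs. *)
Lemma gauss_smoothing_shift p (t T : R) (a : V) : radial_semigroup p ->
  (0 < t)%R -> (t < T)%R -> exists2 C : R, (0 < C)%R &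
  forall z, gauss_smoothing t (p t) (z + a) <= C%:E * gauss_smoothing T (p T) z.
Proof.
move=> Hp t0 tT; have T0 : (0 < T)%R by exact: lt_trans tT.
have Tt : (0 < T - t)%R by rewrite subr_gt0.
have [dt _ _ _] := Hp _ t0; have [dT _ _ _] := Hp _ T0.
have [dr _ _ /(_ _ t0)] := Hp _ Tt; rewrite (addrC t) subrK => TE.
have [K K0 half] := density_half_ball dr.
have [C C0 HC] := @gauss_kernel_shift R n t T (enorm a + K)%R t0 tT.
exists (2 * C)%R; first by rewrite mulr_gt0.
move=> z; have h0 u : (0 <= g t (z + a - u))%R by rewrite ltW// gauss_kernel_gt0.
rewrite EFinM -muleA -lee_pdivrMl//.
apply: (gauss_smoothing_ge_of_sum (z := z) dt dr dT TE T0 (ltW C0) h0 half).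
move=> u v vK; apply: HC.
rewrite (_ : _ - _ = a + v)%R; last by rewrite opprB 2!addrA subrK -(addrA z) (addrC z) addrK.
by rewrite (le_trans (ler_enormD _ _))// lerD2l ltW.
Qed.

Lemma gauss_smoothing_ge t q (M : R) : is_density q -> (0 < t)%R ->
  exists2 c : R, (0 < c)%R & forall z, (enorm z <= M)%R -> c%:E <= gauss_smoothing t q z.
Proof.
move=> dq t0; have [K K0 half] := density_half_ball dq.
have [c c0 Hc] := @gauss_kernel_ge R n t (M + K)%R t0.
exists (2^-1 * c)%R; first by rewrite mulr_gt0// invr_gt0.
move=> z zM; rewrite EFinM.
apply: (@le_trans _ _ (dexp q (fun x => (\1_(eball 0 K) x)%:E) * c%:E)).
  by rewrite lee_wpmul2r// lee_fin ltW.
apply: dexp_ge_indic => //; first exact: measurable_eball.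
- by rewrite lee_fin ltW.
- by move=> u; rewrite lee_fin ltW// gauss_kernel_gt0.
move=> u; rewrite /eball/= subr0 lee_fin => uK; apply: Hc.
by rewrite (le_trans (ler_enormB _ _))// lerD// ltW.
Qed.

Lemma integral_gauss_reflect t z : is_density (g t) ->
  \int[mu]_u (g t (z - u))%:E = 1.
Proof.
move=> [g0 mg <-]; rewrite (ge0_integral_reflect z (f := EFin \o g t))//.
exact/measurable_EFinP.
Qed.

(** One of [u] and [z - u] is at least as long as [e]. The kernel evaluated there is bounded by its
    value at [e], and the other kernel integrates to 1. *)
Lemma gauss_smoothing_le t q (e z : V) : is_density q -> radial_decreasing q ->
  is_density (g t) -> (0 < t)%R -> e != 0%R -> (2 * enorm e <= enorm z)%R ->
  gauss_smoothing t q z <= (q e + g t e)%:E.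
Proof.
move=> dq rq dg t0 e0 ez; have [q0 mq q1] := dq.
have mgz := measurable_gauss_reflect t z.
have g0 u : (0 <= g t u)%R by rewrite ltW// gauss_kernel_gt0.
rewrite EFinD -[X in X + _]mule1 -(integral_gauss_reflect z dg) -[X in _ + X]mule1 -q1.
have mq' : measurable_fun setT (EFin \o q) by exact/measurable_EFinP.
rewrite -(ge0_integralZl_EFin mu measurableT _ mgz)//; last by move=> u _; rewrite lee_fin.
rewrite -(ge0_integralZl_EFin mu measurableT _ mq')//; last by move=> u _; rewrite lee_fin.
rewrite -ge0_integralD//; first last.
- exact: measurable_funeM.
- by move=> u _; rewrite -EFinM lee_fin mulr_ge0.
- exact: measurable_funeM.
- by move=> u _; rewrite -EFinM lee_fin mulr_ge0.
apply: ge0_le_integralT => u; first by rewrite -EFinM lee_fin mulr_ge0.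
rewrite -!EFinM -EFinD lee_fin; have [eu|ue] := leP (enorm e) (enorm u).
  by rewrite (ler_wpDr (mulr_ge0 (g0 e) (q0 u)))// ler_wpM2r// rq.
rewrite (ler_wpDl (mulr_ge0 (q0 e) (g0 (z - u)%R)))// mulrC ler_wpM2r//; apply: gauss_kernel_decr => //.
have := ler_enormD (z - u) u; rewrite subrK; lra.
Qed.

(* A jump to z with |z| large is either made by the Gaussian, which then pays
   like the Gaussian at time T, or made by p t close to z, where p t is
   controlled by local averages of p T. *)
Lemma gauss_smoothing_far p (S T : R) : (0 < n)%N -> radial_semigroup p ->
  (forall t, (0 < t)%R -> is_density (g t)) ->
  (0 < S)%R -> (2 * S < T)%R -> exists Gam C : R, [/\ (0 < Gam)%R, (0 < C)%R &
  forall t z, (0 < t < S)%R -> (Gam <= enorm z)%R ->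
    gauss_smoothing t (p t) z <= C%:E * gauss_smoothing T (p T) z].
Proof.
move=> n0 Hp dg S0 ST; have ST' : (S < T)%R by lra.
have T0 : (0 < T)%R by exact: lt_trans ST'.
have [dT _ _ _] := Hp _ T0.
have [rho [b [rho0 b0 Hb]]] := off_center_ball n0 Hp S0 ST'.
(* Two comparisons of Gaussians: off the ball of radius [rho], from [t] to [2 * S] uniformly in [t];
   then from [2 * S] to [T] with a shift, which requires [2 * S < T]. *)
have [C2 C20 HC2] := gauss_kernel_off_origin n0 S0 rho0.
have S20 : (0 < 2 * S)%R by rewrite mulr_gt0.
have [C1 C10 HC1] := @gauss_kernel_shift R n (2 * S)%R T rho S20 ST.
have [c3 c30 Hc3] := @gauss_kernel_ge R n T (2 * rho)%R T0.
(* A lower bound for the integral of the Gaussian at time [T], centred at [z], over a ball of radius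
   [rho / 4] whose centre is within [rho] of [z]. *)
pose m := (c3 * (rho / 4 / n%:R) ^+ n)%R.
have m0 : (0 < m)%R by rewrite mulr_gt0// exprn_gt0// !divr_gt0// ltr0n.
exists (2 * rho)%R, ((b * m)^-1 + b^-1 * (C2 * C1))%R; split.
- by rewrite mulr_gt0.
- by rewrite addr_gt0// ?mulr_gt0// invr_gt0// mulr_gt0.
move=> t z /andP[t0 tS] zrho.
have Tt : (0 < T - t)%R by rewrite subr_gt0; exact: lt_trans ST'.
have [dt rt _ _] := Hp _ t0.
have [dr _ _ /(_ _ t0)] := Hp _ Tt; rewrite (addrC t) subrK => TE.
have {}Hb v : enorm v = (rho / 2)%R ->
    b%:E <= dexp (p (T - t)%R) (fun x => (\1_(eball v (rho / 4)) x)%:E).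
  by move=> ?; apply: Hb => //; rewrite t0.
have bK : b%:E <= dexp (p (T - t)%R) (fun x => (\1_(eball 0 rho) x)%:E).
  have [v vE] : exists v : V, enorm v = (rho / 2)%R.
    by apply: exists_enorm_eq => //; rewrite divr_ge0// ltW.
  apply: (le_trans (Hb v vE)); apply: le_dexp_indic => // x.
  rewrite /eball/= subr0 => xv; have := ler_enormD (x - v) v; rewrite subrK vE; lra.
have g0 s u : (0 < s)%R -> (0 <= g s u)%R by move=> s0; rewrite ltW// gauss_kernel_gt0.
have [p0 mp _] := dt.
set M := gauss_smoothing T (p T) z.
have M0 : 0 <= M by exact: gauss_smoothing_ge0.
pose A : set V := [set u | (rho <= enorm (u - z))%R].
have mA : measurable A.
  rewrite (_ : A = [set u : V | `[rho, +oo[%classic (enorm (u - z))]).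
    exact: measurable_enorm_ball.
  by apply/seteqP; split => u; rewrite /A/= in_itv/= andbT.
pose h u : R := (g t (z - u) * \1_A u)%R.
have h0 u : (0 <= h u)%R by rewrite mulr_ge0// g0.
have mh : measurable_fun setT (EFin \o h).
  apply/measurable_EFinP; apply: measurable_funM; last exact: measurable_indic.
  by apply/measurable_EFinP; exact: measurable_gauss_reflect.
have far : dexp (p t) (EFin \o h) <= (b^-1 * (C2 * C1))%:E * M.
  rewrite EFinM -muleA lee_pdivlMl//.
  apply: (gauss_smoothing_ge_of_sum (K := rho) dt dr dT TE) => //.
    by rewrite ltW// mulr_gt0.
  move=> u v vrho; rewrite /h indicE; case: (boolP (u \in A)) => [/set_mem Au|_]; last first.
    rewrite mulr0; apply: mulr_ge0; last exact: g0.
    by apply: mulr_ge0; exact: ltW.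
  rewrite mulr1 (le_trans (HC2 t _ _ _)) ?t0//; first by rewrite enormB.
  rewrite -mulrA ler_wpM2l ?(ltW C20)//; apply: HC1.
  by rewrite opprB 2!addrA subrK (addrC z) addrK ltW.
(* When the Gaussian increment is short, [w] has norm at least [rho], so [average_le_of_sum] applies
   with the Gaussian at time [T] as test function. *)
have near w : (enorm (w - z) < rho)%R -> (p t w)%:E <= ((b * m)^-1)%:E * M.
  move=> wz; have bm : (0 < b * m)%R by exact: mulr_gt0.
  rewrite lee_pdivlMl//.
  have rw : (rho <= enorm w)%R.
    have := ler_enormD (z - w) w; rewrite subrK (enormB z w); lra.
  have mF := measurable_gauss_reflect T z.
  have F0 u : 0 <= (g T (z - u))%:E by rewrite lee_fin g0.
  apply: le_trans (average_le_of_sum dt rt dr TE rho0 rw (ltW b0) Hb mF F0).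
  rewrite EFinM -muleA lee_wpmul2l ?lee_fin ?(ltW b0)// muleC lee_wpmul2l ?lee_fin//.
  rewrite /m EFinM; apply: (@le_trans _ _ (c3%:E * mu (eball w (rho / 4)%R))).
    rewrite lee_wpmul2l ?lee_fin ?(ltW c30)//; apply: eball_volume_ge => //.
    by rewrite divr_gt0.
  rewrite -integral_cst; last exact: measurable_eball.
  rewrite integral_mkcond [leRHS]integral_mkcond; apply: ge0_le_integralT => u.
    by rewrite patchE; case: ifP => // _; rewrite lee_fin ltW.
  rewrite !patchE; case: ifPn => // /set_mem; rewrite /eball/= => uw.
  rewrite lee_fin; apply: Hc3; rewrite enormB.
  have := ler_enorm_dist u w z; lra.
have bm0 : 0 <= ((b * m)^-1)%:E by rewrite lee_fin invr_ge0 mulr_ge0 ?(ltW b0) ?(ltW m0).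
have bC0 : 0 <= (b^-1 * (C2 * C1))%:E.
  by rewrite lee_fin ltW// mulr_gt0 ?invr_gt0// mulr_gt0.
rewrite EFinD (ge0_muleDl _ bm0 bC0).
apply: le_trans (leeD (lexx _) far).
(* Inserting the total mass 1 of the Gaussian turns the [near] bound into an integral, so that both
   cases can be compared pointwise in [u]. *)
rewrite -[X in X + _]mule1 -(integral_gauss_reflect z (dg _ t0)).
have bmM0 : 0 <= ((b * m)^-1)%:E * M by exact: mule_ge0.
pose P (u : V) := ((b * m)^-1)%:E * M * (g t (z - u))%:E.
pose Q (u : V) := (p t u)%:E * (h u)%:E.
have P0 u : 0 <= P u by rewrite mule_ge0// lee_fin g0.
have Q0 u : 0 <= Q u by rewrite mule_ge0// lee_fin.
have mP : measurable_fun setT P.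
  by apply: measurable_funeM; exact: measurable_gauss_reflect.
have mQ : measurable_fun setT Q by apply: emeasurable_funM => //; exact/measurable_EFinP.
rewrite -ge0_integralZl//; [|exact: measurable_gauss_reflect|by move=> u _; rewrite lee_fin g0].
rewrite -[leRHS](@ge0_integralD _ _ _ mu setT measurableT P Q)//.
rewrite /P /Q; apply: ge0_le_integralT => u; first by rewrite mule_ge0// lee_fin ?g0.
have [uz|uz] := leP rho (enorm (u - z)).
  by rewrite /h /= indicE mem_set// mulr1 leeDr// mule_ge0// lee_fin g0.
apply: (@le_trans _ _ (((b * m)^-1)%:E * M * (g t (z - u))%:E)).
  by rewrite lee_wpmul2r ?lee_fin ?g0//; exact: near.
by rewrite leeDl// mule_ge0// lee_fin.
Qed.

End smoothed_semigroup.

(** * Densities of the processes *)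

Section process_densities.
Context {R : realType} {n : nat} {d : measure_display} {Omega : measurableType d}.
Context {P : probability Omega R}.
Local Notation V := 'rV[R]_n.
Local Notation mu := (@lebesgue_rV R n).
Implicit Types (X : R -> Omega -> V) (Z : Omega -> V) (q : V -> R).
Local Open Scope ereal_scope.

Lemma has_density_is_density Z q : has_density P Z q -> is_density q.
Proof.
move=> [q0 mq qE]; split => //.
by rewrite -(qE setT)// preimage_setT probability_setT.
Qed.

Lemma measurable_increment X (s t : R) : levy_process P X -> (0 <= s)%R -> (0 <= t)%R ->
  measurable_fun setT (increment X s t).
Proof.
move=> [mX _ _ _ _] s0 t0.
have mXX : measurable_fun setT (fun w => (X t w, X s w)).
  by apply: measurable_fun_pair; exact: mX.
exact: (measurableT_comp measurable_rV_sub mXX).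
Qed.

(** The process starts at 0 only almost surely, so the two events may differ by a null set. *)
Lemma law_increment0 X t A : levy_process P X -> (0 <= t)%R -> measurable A ->
  P (increment X 0 t @^-1` A) = P (X t @^-1` A).
Proof.
move=> LX t0 mA; have [mX X00 _ _ _] := LX.
have m1 : measurable (increment X 0 t @^-1` A).
  by rewrite -[X in measurable X]setTI; apply: measurable_increment.
have m2 : measurable (X t @^-1` A) by rewrite -[X in measurable X]setTI; exact: mX.
have PE C : measurable C -> P C = \int[P]_w (\1_C w)%:E.
  by move=> mC; rewrite integral_indic// setIT.
rewrite !PE//.
apply: ge0_ae_eq_integral => //; try by move=> w _; rewrite lee_fin.
- exact/measurable_EFinP/measurable_indic.
- exact/measurable_EFinP/measurable_indic.
apply: filterS X00 => w X0w _.
by rewrite !indicE; congr ((_ : bool)%:R%:E); apply/idP/idP => /set_mem wA;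
  apply/mem_set; move: wA; rewrite /= /increment X0w subr0.
Qed.

(** The increments over [[0, s]] and [[s, s + t]] have a product joint law by independence and
    uniqueness of product measures; stationarity gives the second the density [p t], and Tonelli
    computes the law of the sum. *)
Lemma levy_density_of_sum X (p : R -> V -> R) (s t : R) : levy_process P X ->
  (forall t : R, (0 < t)%R -> has_density P (X t) (p t)) -> (0 < s)%R -> (0 < t)%R ->
  density_of_sum (p s) (p t) (p (s + t)%R).
Proof.
move=> LX pE s0 t0 F mF F0.
have [mX X00 _ indep stat] := LX.
have st0 : (0 < s + t)%R by rewrite addr_gt0.
have mU := measurable_increment LX (lexx 0%R) (ltW s0).
have mW := measurable_increment LX (ltW s0) (ltW st0).
have mUW : measurable_fun setT (fun w => (increment X 0 s w, increment X s (s + t) w)).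
  exact: measurable_fun_pair.
pose U : {mfun Omega >-> V} := HB.pack (increment X 0 s) (isMeasurableFun.Build _ _ _ _ _ mU).
pose W : {mfun Omega >-> V} := HB.pack (increment X s (s + t)) (isMeasurableFun.Build _ _ _ _ _ mW).
pose Z : {mfun Omega >-> (V * V)%type} := HB.pack (fun w => (U w, W w)) (isMeasurableFun.Build _ _ _ _ _ mUW).
have UE A : measurable A -> distribution P U A = \int[mu]_(x in A) (p s x)%:E.
  move=> mA; have [_ _ <-//] := pE s s0.
  by rewrite -(law_increment0 LX (ltW s0) mA).
have WE A : measurable A -> distribution P W A = \int[mu]_(x in A) (p t x)%:E.
  move=> mA; have [_ _ <-//] := pE t t0.
  by rewrite -(law_increment0 LX (ltW t0) mA) -(stat s t (ltW s0) (ltW t0) A mA).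
have ZE A B : measurable A -> measurable B ->
    distribution P Z (A `*` B) = distribution P U A * distribution P W B.
  move=> mA mB.
  (* The times are 0, [s], [s + t]; the last one is the default value of [nth]. *)
  have := indep 2%N (fun i => nth (s + t) [:: 0; s] i)%R (fun i => if i == 0%N then A else B).
  rewrite /= big_ord_recl big_ord1 /=.
  move=> /(_ (lexx _)) <-//.
  - congr (P _); apply/seteqP; split => w.
      by move=> [/= wA wB] [|[|i]].
    by move=> h; split; [exact: (h 0%N)|exact: (h 1%N)].
  - by case=> [|[|]]//= _; [exact: ltW|rewrite lerDl ltW].
  - by case.
have mFadd : measurable_fun setT (fun z : V * V => F (z.1 + z.2)%R).
  exact: (measurableT_comp mF measurable_rV_add).
have [ps0 mps _] := pE s s0; have [pt0 mpt _] := pE t t0.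
have [pst0 mpst pstE] := pE _ st0.
have mXst := measurable_increment LX (lexx 0%R) (ltW st0).
pose Xst : {mfun Omega >-> V} := HB.pack (increment X 0 (s + t)) (isMeasurableFun.Build _ _ _ _ _ mXst).
transitivity (\int[distribution P Xst]_x F x).
  apply/esym; apply: (@ge0_integral_with_density _ _ _ mu (distribution P Xst)) => //.
  by move=> A mA; rewrite -pstE// -(law_increment0 LX (ltW st0) mA).
rewrite ge0_integral_distribution//.
transitivity (\int[distribution P Z]_z F (z.1 + z.2)%R).
  rewrite (ge0_integral_distribution Z)//.
  apply: eq_integral => w _ /=; congr F.
  by rewrite /increment [RHS]addrC subrKA.
transitivity (\int[distribution P U \x distribution P W]_z F (z.1 + z.2)%R).
  by apply: eq_measure_integral => A mA _; apply/esym/product_measure_unique.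
rewrite fubini_tonelli2//.
transitivity (\int[distribution P W]_v dexp (p s) (fun u => F (u + v)%R)).
  apply: eq_integral => v _; apply: (@ge0_integral_with_density _ _ _ mu (distribution P U)) => //.
  exact: (measurableT_comp mF (measurable_rV_translate v)).
apply: (@ge0_integral_with_density _ _ _ mu (distribution P W)) => //.
  by apply: measurable_dexp_add => //; exact: has_density_is_density (pE s s0).
by move=> v; apply: dexp_ge0 => //; exact: has_density_is_density (pE s s0).
Qed.

Lemma unimodal_levy_radial_semigroup X p psi nu :
  isotropic_unimodal_pure_jump_levy P X p psi nu -> radial_semigroup p.
Proof.
move=> [LX pX _ _ _] t t0; have [pt rot mono] := pX t t0; split.
- exact: has_density_is_density pt.
- exact: radially_nonincreasing_enorm.
- by move=> x; exact: rotation_invariantN.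
- move=> s s0; apply: (levy_density_of_sum LX) => // u u0.
  by have [] := pX u u0.
Qed.

(** The Gaussian kernel has mass 1 because it is the density of an increment of [B]; no Gaussian
    integral is computed. *)
Lemma brownian_gauss_density (B : R -> Omega -> V) (t : R) : double_speed_brownian_motion P B ->
  (0 < t)%R -> is_density (@gauss_kernel R n t).
Proof.
move=> [_ _ _ _ /(_ 0%R t)]; rewrite subr0 => H t0.
by apply: has_density_is_density; apply: H; rewrite lexx.
Qed.

End process_densities.

(** * Maximal function *)

Section maximal_function_bound.
Context {R : realType} {n : nat}.
Local Notation V := 'rV[R]_n.
Local Notation mu := (@lebesgue_rV R n).
Implicit Types (f : V -> \bar R) (x y z : V).
Local Open Scope ereal_scope.

Lemma local_HL_maximal_ge0 (r : R) f x : (0 < r)%R -> 0 <= local_HL_maximal r f x.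
Proof.
move=> r0; apply: (@le_trans _ _ ((mu (eball x (r / 2)))^-1 *
    \int[mu]_(y in eball x (r / 2)%R) `|f y|)).
  by rewrite mule_ge0 ?inve_ge0// integral_ge0.
by apply: ereal_sup_ubound; exists (r / 2)%R => //=; lra.
Qed.

Lemma integral_eball_le_maximal (r s : R) f x : (0 < n)%N -> (forall y, 0 <= f y) ->
  (0 < s < r)%R ->
  \int[mu]_(y in eball x s) f y <= mu (eball x s) * local_HL_maximal r f x.
Proof.
move=> n0 f0 sr; have /andP[s0 _] := sr.
have : (mu (eball x s))^-1 * \int[mu]_(y in eball x s) f y <= local_HL_maximal r f x.
  apply: ereal_sup_ubound; exists s => //.
  by congr (_ * _); apply: eq_integral => y _; rewrite gee0_abs.
have := eball_volume_gt0 x s0 n0; have := eball_volume_fin x (ltW s0).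
case: (mu _) => [v| |]// _; rewrite lte_fin => v0.
by rewrite inver gt_eqF// lee_pdivrMl.
Qed.

(* Dyadic annuli: K is at most H e on an annulus around x, for any e of a quarter
   of its outer radius, and the mass H e times the volume of the surrounding ball
   is controlled by the integral of H over a ball D k lying one scale further in. *)
Lemma radial_majorant_maximal (K H : V -> R) (Gam : R) f x : (0 < n)%N ->
  (0 < Gam)%R -> (forall z, (0 <= K z)%R) -> measurable_fun setT K ->
  (forall z, (0 <= H z)%R) -> measurable_fun setT H -> radial_decreasing H ->
  (forall e z, e != 0%R -> (2 * enorm e <= enorm z)%R -> (K z <= H e)%R) ->
  measurable_fun setT f -> (forall y, 0 <= f y) ->
  \int[mu]_(y in eball x Gam `\ x) ((K (x - y))%:E * f y) <=
  (\int[mu]_z (H z)%:E) * (((32 * n%:R) ^+ n)%:E * local_HL_maximal (2 * Gam) f x).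
Proof.
move=> n0 Gam0 K0 mK H0 mH rH KH mf f0.
have n1 : (0 < n%:R :> R)%R by rewrite ltr0n.
set M := local_HL_maximal _ _ _.
have Gam20 : (0 < 2 * Gam)%R by rewrite mulr_gt0.
have M0 : 0 <= M by exact: local_HL_maximal_ge0.
set C : R := ((32 * n%:R) ^+ n)%R.
have C0 : (0 <= C)%R by rewrite exprn_ge0// mulr_ge0// ltW.
pose s k : R := (Gam / 2 ^+ k)%R.
have s0 k : (0 < s k)%R by rewrite divr_gt0// exprn_gt0.
have sS k : s k.+1 = (s k / 2)%R by rewrite /s exprS; field; rewrite expf_neq0.
have sle k l : (k <= l)%N -> (s l <= s k)%R.
  by move=> kl; rewrite ler_wpM2l ?(ltW Gam0)// lef_pV2 ?posrE ?exprn_gt0// ler_eXn2l// ltr1n.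
pose A k : set V := [set y | `[s k / 2, s k[%classic (enorm (y - x))]%R.
have mA k : measurable (A k) by exact: measurable_enorm_ball.
have AE k y : A k y <-> (s k / 2 <= enorm (y - x) < s k)%R by rewrite /A/= in_itv.
have UA : \bigcup_k A k = eball x Gam `\ x.
  apply/seteqP; split => y.
    move=> [k _ /AE/andP[yk ky]]; split.
      by rewrite /eball/=; apply: lt_le_trans ky _; have := sle _ _ (leq0n k); rewrite {2}/s expr0 divr1.
    move=> /= yx; move: yk; rewrite yx subrr enorm0 leNgt divr_gt0//.
  move=> [yG /eqP yx]; have yx0 : (0 < enorm (y - x))%R by rewrite enorm_gt0 subr_eq0.
  (* The least such [k] is the index of the annulus containing [y]. *)
  have ex : exists k, (s k.+1 <= enorm (y - x))%R.
    exists (Num.truncn (Gam / enorm (y - x))); rewrite /s ler_pdivrMr ?exprn_gt0//.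
    rewrite mulrC -ler_pdivrMr//; apply: ltW; apply: lt_le_trans (truncnS_gt _) _.
    by rewrite -natrX ler_nat; exact: ltnW (ltn_expl _ _).
  exists (ex_minn ex) => //; case: ex_minnP => k yk kmin; apply/AE.
  rewrite -sS yk/=; case: k yk kmin => [|k] yk kmin.
    by rewrite /s expr0 divr1.
  by rewrite ltNge; apply/negP => /kmin; rewrite ltnn.
have tA : trivIset setT A.
  apply: ltn_trivIset => k l lk; rewrite -subset0 => y [/AE/andP[yl _] /AE/andP[_ yk]].
  have := sle _ _ lk; rewrite sS; lra.
(* With this centre, the ball of radius [s k / 16] lies strictly between radii [s k / 8] and
   [s k / 4], which makes the balls [D k] disjoint. *)
have /choice[c cE] : forall k, exists c : V, enorm c = (3 * s k / 16)%R.
  move=> k; apply: exists_enorm_eq => //.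
  by rewrite divr_ge0// mulr_ge0// ltW.
pose D k : set V := eball (c k) (s k / 16).
have mD k : measurable (D k) by exact: measurable_eball.
have DE k u : D k u -> (s k / 8 < enorm u < s k / 4)%R.
  rewrite /D /eball/= => uc; have := ler_enormD (u - c k) (c k); rewrite subrK cE.
  have := ler_enormD (c k - u) u; rewrite subrK cE (enormB (c k) u).
  by move=> ? ?; apply/andP; split; lra.
have tD : trivIset setT D.
  apply: ltn_trivIset => k l lk; rewrite -subset0 => u [/DE/andP[ul _] /DE/andP[_ uk]].
  have := sle _ _ lk; rewrite sS; lra.
have mKf : measurable_fun setT (fun y => (K (x - y))%:E * f y).
  apply: emeasurable_funM => //; apply/measurable_EFinP.
  exact: (measurableT_comp mK (measurable_rV_reflect x)).
have mHM : measurable_fun setT (fun u => (H u)%:E * (C%:E * M)).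
  by apply: emeasurable_funM => //; exact/measurable_EFinP.
have Kf0 y : 0 <= (K (x - y))%:E * f y by rewrite mule_ge0// lee_fin.
have CM0 : 0 <= C%:E * M by rewrite mule_ge0// lee_fin.
have HM0 u : 0 <= (H u)%:E * (C%:E * M) by rewrite mule_ge0// lee_fin.
have piece k : \int[mu]_(y in A k) ((K (x - y))%:E * f y) <=
    \int[mu]_(u in D k) ((H u)%:E * (C%:E * M)).
  have [e eE] : exists e : V, enorm e = (s k / 4)%R.
    by apply: exists_enorm_eq => //; rewrite divr_ge0// ltW.
  have e0 : e != 0%R by rewrite -enorm_gt0 eE divr_gt0.
  (* The radius [s 0] equals [Gam], whereas the maximal function uses radii strictly below its
     bound; hence [2 * Gam]. *)
  have sk2 : (0 < s k < 2 * Gam)%R.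
    by rewrite s0/=; have := sle _ _ (leq0n k); rewrite {2}/s expr0 divr1; lra.
  apply: (@le_trans _ _ ((H e)%:E * \int[mu]_(y in eball x (s k)) f y)).
    rewrite -ge0_integralZl_EFin//; [|exact: measurable_eball|exact: measurable_funTS].
    rewrite [leLHS]integral_mkcond [leRHS]integral_mkcond; apply: ge0_le_integralT => y.
      by rewrite patchE; case: ifP.
    rewrite !patchE; case: ifPn => [/set_mem/AE/andP[yk ky]|_]; last first.
      by case: ifP => // _; rewrite mule_ge0// lee_fin.
    rewrite mem_set// lee_wpmul2r// lee_fin; apply: KH => //.
    by rewrite eE enormB; lra.
  apply: (@le_trans _ _ ((H e)%:E * (((2 * s k) ^+ n)%:E * M))).
    rewrite lee_wpmul2l ?lee_fin//.
    apply: le_trans (integral_eball_le_maximal x n0 f0 sk2) _.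
    by rewrite lee_wpmul2r//; exact: eball_volume_le (ltW (s0 k)).
  (* [C] is the ratio of the upper volume bound for the ball of radius [s k] to the lower one for
     [D k]. *)
  rewrite (_ : (2 * s k) ^+ n = (s k / 16 / n%:R) ^+ n * C)%R; last first.
    by rewrite -exprMn; congr (_ ^+ _)%R; field; rewrite gt_eqF.
  rewrite EFinM -(muleA _ _ M) (muleA (H e)%:E).
  apply: (@le_trans _ _ (((H e)%:E * mu (D k)) * (C%:E * M))).
    rewrite lee_wpmul2r// lee_wpmul2l ?lee_fin//; apply: eball_volume_ge => //.
    by rewrite divr_gt0.
  rewrite ge0_integralZr//; last 2 first.
  - by apply/measurable_EFinP; exact: measurable_funTS.
  - by move=> u _; rewrite lee_fin.
  rewrite lee_wpmul2r// -integral_cst// [leLHS]integral_mkcond [leRHS]integral_mkcond.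
  apply: ge0_le_integralT => u; first by rewrite patchE; case: ifP; rewrite ?lee_fin.
  rewrite !patchE; case: ifPn => // /set_mem /DE/andP[uk ku].
  rewrite lee_fin; apply: rH; last by rewrite eE ltW.
  by rewrite -enorm_gt0 (lt_trans _ uk)// divr_gt0.
rewrite -UA ge0_integral_bigcup//; last exact: measurable_funTS.
apply: (@le_trans _ _ (\sum_(0 <= k <oo) \int[mu]_(u in D k) ((H u)%:E * (C%:E * M)))).
  by apply: lee_nneseries => [k _ _|k _]; [exact: integral_ge0|exact: piece].
rewrite -ge0_integral_bigcup//; last exact: measurable_funTS.
rewrite -ge0_integralZr//; last 2 first.
- exact/measurable_EFinP.
- by move=> u _; rewrite lee_fin.
by apply: ge0_subset_integral => //; exact: bigcupT_measurable.
Qed.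

End maximal_function_bound.

(** * Small times *)

Section continuous_functions.
Context {R : realType} {n : nat}.
Local Notation V := 'rV[R]_n.
Implicit Types (f : V -> R).

(* The sigma-algebra is generated by the coordinates; f is the limit of its
   compositions with the rounding of coordinates to multiples of 1 / k. *)
Lemma continuous_measurable_rV f : continuous f -> measurable_fun setT f.
Proof.
move=> cf.
pose pt k (z : 'rV[int]_n) : V := \row_i ((z ord0 i)%:~R / k.+1%:R).
pose fl k (x : V) : 'rV[int]_n := \row_i Num.floor (x ord0 i * k.+1%:R).
apply: (@measurable_fun_cvg _ _ _ _ (fun k x => f (pt k (fl k x)))).
  move=> k _ Y mY; rewrite setTI.
  pose box (z : 'rV[int]_n) : set V := [set x | forall i,
    `[(z ord0 i)%:~R / k.+1%:R, (z ord0 i + 1)%:~R / k.+1%:R[%classic (x ord0 i)].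
  have boxE z x : box z x <-> fl k x = z.
    have k0 : 0 < k.+1%:R :> R by rewrite ltr0n.
    split => [bx|<- i].
      apply/rowP => i; rewrite mxE; apply: floor_def.
      by have := bx i; rewrite /= in_itv/= ler_pdivrMr// ltr_pdivlMr.
    by rewrite /= in_itv/= mxE ler_pdivrMr// ltr_pdivlMr// floor_itv.
  (* The rounded function is constant on each grid box, so the preimage is a countable union of
     boxes. *)
  rewrite (_ : _ @^-1` Y = \bigcup_(z in [set: 'rV[int]_n])
      (if f (pt k z) \in Y then box z else set0)); last first.
    apply/seteqP; split => [x Yx|x [z _]].
      by exists (fl k x) => //; rewrite mem_set//; exact/boxE.
    by case: ifPn => // /set_mem Yz /boxE zE; rewrite /= zE.
  apply: countable_bigcupT_measurable; first exact: countableP.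
  move=> z; case: ifP => _ //.
  exact: (measurable_box (A := fun i =>
    `[(z ord0 i)%:~R / k.+1%:R, (z ord0 i + 1)%:~R / k.+1%:R[%classic)).
move=> x _; apply: (@cvg_comp _ _ _ (fun k => pt k (fl k x)) f _ (nbhs x)); last exact: cf.
apply/cvgrPdist_le => e e0; near=> k.
rewrite -[leLHS]/(mx_norm _) mx_normrE; apply/bigmax_leP; split; first exact: ltW.
move=> [i j] _ /=; rewrite ord1 !mxE.
have k0 : 0 < k.+1%:R :> R by rewrite ltr0n.
have /andP[h1 h2] := floor_itv (x ord0 j * k.+1%:R).
apply: (@le_trans _ _ (k.+1%:R^-1)); last first.
  by near: k; apply: filterS (near_infty_natSinv_lt (PosNum e0)) => k /ltW.
rewrite ger0_norm; last by rewrite subr_ge0 ler_pdivrMr.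
rewrite lerBlDr -[X in X + _]mul1r -mulrDl ler_pdivlMr//.
by rewrite intrD in h2; rewrite addrC ltW.
Unshelve. all: by end_near. Qed.

Lemma compactly_supported_bounded f : continuous f -> compactly_supported f ->
  exists2 M : R, 0 <= M & forall x, `|f x| <= M.
Proof.
move=> cf Kf.
have cK : compact (f @` closure [set x | f x != 0]).
  by apply: continuous_compact => //; exact: continuous_subspaceT.
have [M [_ HM]] := compact_bounded cK.
exists (`|M| + 1); first by rewrite addr_ge0.
move=> x; have [->|fx] := eqVneq (f x) 0; first by rewrite normr0 addr_ge0.
apply: (HM (`|M| + 1)); first by rewrite (le_lt_trans (ler_norm _))// ltrDl.
by exists x => //; exact: subset_closure.
Qed.

End continuous_functions.

(** * Error of averaging against a concentrated density *)

Section approximate_identity.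
Context {R : realType} {n : nat}.
Local Notation V := 'rV[R]_n.
Local Notation mu := (@lebesgue_rV R n).
Implicit Types (q f : V -> R).
Local Open Scope ereal_scope.

(** Since [q] has mass 1, the error is the average of [f y - f x] against [q (x - y)]: at most [e]
    within distance [dlt], and at most [2 * M] beyond it. *)
Lemma mean_value_error q f x (M e dlt : R) : is_density q -> measurable_fun setT f ->
  (forall y, `|f y| <= M)%R -> (0 <= e)%R ->
  (forall y, enorm (y - x) < dlt -> `|f y - f x| <= e)%R ->
  `|\int[mu]_y (q (x - y) * f y)%:E - (f x)%:E| <=
  e%:E + (2 * M)%:E * dexp q (fun z => (\1_(~` eball 0 dlt) z)%:E).
Proof.
move=> dq mf fM e0 fe; have [q0 mq q1] := dq.
have M0 : (0 <= M)%R by exact: le_trans (normr_ge0 _) (fM 0%R).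
pose r (y : V) := q (x - y)%R.
have mr : measurable_fun setT r by exact: (measurableT_comp mq (measurable_rV_reflect x)).
have mr' : measurable_fun setT (EFin \o r) by exact/measurable_EFinP.
have r0 y : (0 <= r y)%R by exact: q0.
have r1 : \int[mu]_y (r y)%:E = 1.
  rewrite -q1 -(ge0_integral_reflect x (f := EFin \o q))//.
  exact/measurable_EFinP.
have dr : is_density r by split.
have ir : mu.-integrable setT (EFin \o r).
  apply/integrableP; split => //.
  under eq_integral do rewrite gee0_abs ?lee_fin//.
  by rewrite r1 ltry.
have irf : mu.-integrable setT (fun y => (r y * f y)%:E).
  apply: (@le_integrable _ _ _ mu setT measurableT _ (fun y => M%:E * (r y)%:E)).
  - by apply/measurable_EFinP; exact: measurable_funM.
  - move=> y _; rewrite -EFinM !abse_EFin lee_fin normrM mulrC normrM.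
    by rewrite ler_wpM2r// (ger0_norm M0).
  - exact: integrableZl.
have irx : mu.-integrable setT (fun y => (f x)%:E * (r y)%:E) by exact: integrableZl.
have -> : (f x)%:E = \int[mu]_y ((f x)%:E * (r y)%:E).
  by rewrite integralZl// r1 mule1.
rewrite -integralB//.
have mB : measurable_fun setT (fun y => (r y * f y)%:E - (f x)%:E * (r y)%:E).
  by apply: emeasurable_funB; [exact: measurable_int irf|exact: measurable_int irx].
apply: (le_trans (le_abse_integral mu measurableT mB)).
set A := ~` eball 0 dlt.
have mA : measurable A by apply: measurableC; exact: measurable_eball.
have mIA : measurable_fun setT (fun y : V => (\1_A (x - y)%R : R)%:E).
  exact: (measurableT_comp (measurable_fun_EFin_indic mA) (measurable_rV_reflect x)).
have -> : dexp q (fun z => (\1_A z)%:E) = dexp r (fun y => (\1_A (x - y)%R)%:E).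
  rewrite /dexp -[LHS](ge0_integral_reflect x)//.
    by apply: emeasurable_funM; [exact/measurable_EFinP|exact: measurable_fun_EFin_indic].
  by move=> z; rewrite mule_ge0// lee_fin.
rewrite muleC -(dexpZr dr mIA)//; last by rewrite lee_fin mulr_ge0.
rewrite -[X in X + _](dexp_cst dr (k := e%:E))//.
have mIAM : measurable_fun setT (fun y : V => (\1_A (x - y)%R : R)%:E * (2 * M)%:E).
  exact: emeasurable_funM.
rewrite -(dexpD dr (measurable_cst e%:E) _ mIAM)//; last first.
  by move=> y; rewrite mule_ge0// lee_fin// mulr_ge0.
apply: ge0_le_integralT => // y.
rewrite -[leRHS]/((r y * (e + \1_A (x - y)%R * (2 * M)))%R%:E).
rewrite -[leLHS]/((`|r y * f y - f x * r y|%R)%:E) lee_fin.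
rewrite (mulrC (f x)) -mulrBr normrM (ger0_norm (r0 y)) ler_wpM2l//.
rewrite indicE mem_eballC0; have [dy|dy] := leP dlt (enorm (x - y)).
  rewrite mul1r (le_trans (ler_normB _ _))// ler_wpDl//.
  by have := fM y; have := fM x; lra.
by rewrite mul0r addr0; apply: fe; rewrite enormB.
Qed.

End approximate_identity.

(** * Convergence of the process to 0 in probability *)

Section small_time.
Context {R : realType} {n : nat} {d : measure_display} {Omega : measurableType d}.
Context {P : probability Omega R}.
Local Notation V := 'rV[R]_n.
Implicit Types (X B Y : R -> Omega -> V).
Local Open Scope ereal_scope.

Lemma measurable_levy_sum X B Y (t : R) :
  levy_process P X -> double_speed_brownian_motion P B ->
  (forall (t : R) w, (0 <= t)%R -> Y t w = (B t w + X t w)%R) -> (0 <= t)%R ->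
  measurable_fun setT (Y t).
Proof.
move=> [mX _ _ _ _] [mB _ _ _ _] YE t0.
rewrite (_ : Y t = (fun p : V * V => (p.1 + p.2)%R) \o (fun w => (B t w, X t w))).
  apply: measurableT_comp; first exact: measurable_rV_add.
  by apply: measurable_fun_pair; [exact: mB|exact: mX].
by apply/funext => w; rewrite /= YE.
Qed.

(** Almost every path of [X] and of [B] starts at 0 and is right-continuous there, so the indicators
    of the tail events tend to 0 almost surely; dominated convergence concludes. *)
Lemma tail_cvg0 X B Y (u : R^nat) (dlt : R) :
  levy_process P X -> double_speed_brownian_motion P B ->
  (forall (t : R) w, (0 <= t)%R -> Y t w = (B t w + X t w)%R) ->
  (0 < dlt)%R -> (forall k, 0 < u k)%R -> u k @[k --> \oo] --> 0%R ->
  P (Y (u k) @^-1` (~` eball 0 dlt)) @[k --> \oo] --> 0.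
Proof.
move=> LX BB YE dlt0 u0 ucvg.
have [_ X00 cadX _ _] := LX; have [_ B00 cB _ _] := BB.
pose A k := Y (u k) @^-1` (~` eball 0 dlt).
have mA k : measurable (A k).
  rewrite -[X in measurable X]setTI.
  by apply: (measurable_levy_sum LX BB YE (ltW (u0 k))) => //;
    apply: measurableC; exact: measurable_eball.
have u_right : u @ \oo --> 0%R^'+.
  move=> U /= [e /= e0 HU]; have [N _ HN] := ucvg _ (nbhsx_ballx 0%R e e0).
  by exists N => // k Nk; exact: (HU (u k) (HN k Nk) (u0 k)).
have := @dominated_convergence _ _ _ P setT measurableT
  (fun k w => (\1_(A k) w)%:E) (cst 0) (cst 1).
case=> //.
- by move=> k; exact/measurable_EFinP/measurable_indic.
- have X0c : {ae P, forall w, X 0%R w = 0%R /\ cadlag (X ^~ w)}.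
    by apply: filterS2 X00 cadX => w.
  move: X0c B00 cB; apply: filterS3 => w [X0w [cadw _]] B0w cBw _.
  have Xcvg : X (u k) w @[k --> \oo] --> (0%R : V).
    rewrite -X0w; apply: (@cvg_comp _ _ _ u (fun s => X s w) _ (0%R^'+) _ u_right).
    exact: (cadw 0%R (lexx _)).
  have Bcvg : B (u k) w @[k --> \oo] --> (0%R : V).
    have B0cvg : B s w @[s --> within `[0%R, +oo[ (nbhs (0%R : R))] --> B 0%R w.
      by move/subspace_continuousP : cBw; apply; rewrite /= in_itv/= lexx.
    rewrite -B0w; apply: (@cvg_comp _ _ _ u (fun s => B s w) _ _ _ _ B0cvg) => U /= wU.
    have [N _ HN] := ucvg _ wU.
    by exists N => // k Nk; apply: (HN k Nk); rewrite /= in_itv/= andbT ltW.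
  have Ycvg : Y (u k) w @[k --> \oo] --> (0%R : V).
    under eq_fun do rewrite YE ?(ltW (u0 _))//.
    by rewrite -(addr0 (0%R : V)); exact: cvgD.
  apply: cvg_near_cst.
  (* Passes from the sup norm to the Euclidean norm; [n.+1] rather than [n] keeps the divisor
     nonzero in dimension 0. *)
  have e0 : (0 < dlt / n.+1%:R)%R by rewrite divr_gt0.
  move/cvgrPdist_lt : Ycvg => /(_ _ e0); apply: filterS => k.
  rewrite sub0r normrN => Yk; rewrite indicE memNset// => /= Ak; apply: Ak.
  rewrite /eball/= subr0; apply: le_lt_trans (enorm_le_sup_norm _) _.
  apply: (@le_lt_trans _ _ (n.+1%:R * `|Y (u k) w|)%R).
    by rewrite ler_wpM2r// ler_nat.
  by rewrite mulrC -ltr_pdivlMr.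
- exact: finite_measure_integrable_cst.
- by apply: aeW => w k _; rewrite gee0_abs// lee_fin.
move=> _ _; rewrite integral0.
by under eq_fun do rewrite integral_indic// setIT.
Qed.

End small_time.

Theorem lemma4p8 (R : realType) (n : nat) (n_gt0 : (0 < n)%N)
    (d : measure_display) (Omega : measurableType d) (P : probability Omega R)
    (X : R -> Omega -> 'rV[R]_n) (p : R -> 'rV[R]_n -> R)
    (psi : 'rV[R]_n -> R) (nu : {measure set 'rV[R]_n -> \bar R})
    (psi0 : R -> R) (alpha_lo alpha_hi c_lo C_hi : R)
    (B Y : R -> Omega -> 'rV[R]_n) (ptilde : R -> 'rV[R]_n -> R)
    (X_levy : isotropic_unimodal_pure_jump_levy P X p psi nu)
    (psi_radial : forall xi, psi xi = psi0 (enorm xi))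
    (psi0_ge0 : forall r : R, 0 <= r -> 0 <= psi0 r)
    (psi0_cont : {within `[0, +oo[, continuous psi0})
    (psi0_incr : {in `[0, +oo[ &, {homo psi0 : r s / r < s}})
    (alpha_lo_gt0 : 0 < alpha_lo) (alpha_le : alpha_lo <= alpha_hi)
    (alpha_hi_lt2 : alpha_hi < 2)
    (c_lo_itv : 0 < c_lo <= 1) (C_hi_ge1 : 1 <= C_hi)
    (psi0_scaling : forall lambda theta : R, 1 <= lambda -> 0 < theta ->
       c_lo * lambda `^ alpha_lo * psi0 theta <= psi0 (lambda * theta)
         <= C_hi * lambda `^ alpha_hi * psi0 theta)
    (B_brownian : double_speed_brownian_motion P B)
    (BX_indep : independent_processes P B X)
    (YE : forall (t : R) w, 0 <= t -> Y t w = B t w + X t w)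
    (Y_density : forall t : R, 0 < t -> has_density P (Y t) (ptilde t))
    (ptildeE : forall (t : R) x, 0 < t ->
       ptilde t x = convolution (gauss_kernel t) (p t) x) :
  let mu := @lebesgue_rV R n in
  let phi (t : R) (x y : 'rV[R]_n) := ptilde t (x - y) in
  [/\
    (* (i) *)
    forall (f : 'rV[R]_n -> R) (x : 'rV[R]_n),
      continuous f -> compactly_supported f ->
      (\int[mu]_y (phi t x y * f y)%:E)%E @[t --> 0^'+] --> (f x)%:E,
    (* (ii) *)
    (exists eta : R, 0 < eta <= 1 /\
       forall (r : R) (x1 x2 : 'rV[R]_n), 0 < r ->
         exists C : R, forall y, phi (eta * r) x1 y <= C * phi r x2 y) /\
    (forall (x : 'rV[R]_n) (r : R) (z : 'rV[R]_n), 0 < r ->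
       exists C : R, 0 < C /\ forall y, y \in eball z r -> C <= phi r x y) &
    (* (iii) *)
    exists (gamma : R) (xi1 xi2 : 'rV[R]_n -> R -> R) (Gamma : R -> R),
      [/\ 1 <= gamma,
          forall x (t : R), 0 < t -> 1 < xi1 x t /\ 1 < xi2 x t,
          forall (t : R) (A : set 'rV[R]_n), 0 < t -> bounded_set A ->
            [bounded xi1 x t | x in A] /\ [bounded xi2 x t | x in A],
          forall t : R, 0 < t -> 0 < Gamma t &
          forall (r : R) (f : 'rV[R]_n -> \bar R) (x : 'rV[R]_n),
            0 < r -> measurable_fun setT f -> (forall y, (0 <= f y)%E) ->
            (ereal_sup [set \int[mu]_y ((phi t x y)%:E * f y)
                       | t in [set t : R | (0 < t < r)%R]]
             <= (xi1 x r)%:E * local_HL_maximal (Gamma r) f x +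
                (xi2 x r)%:E * \int[mu]_y ((phi (gamma * r) x y)%:E * f y))%E]].
Proof.
move=> mu phi.
have [LX _ _ _ _] := X_levy.
have Hp := unimodal_levy_radial_semigroup X_levy.
have dg t := @brownian_gauss_density _ _ _ _ _ B t B_brownian.
have phiE t x : 0 < t -> (ptilde t x)%:E = gauss_smoothing t (p t) x.
  by move=> t0; rewrite ptildeE// convolution_gaussE//; have [] := Hp t t0.
have dpt t : 0 < t -> is_density (ptilde t).
  by move=> t0; exact: has_density_is_density (Y_density t t0).
split.
- move=> f x cf Kf.
  have [M M0 fM] := compactly_supported_bounded cf Kf.
  (* Reduction to sequences of times, as required by dominated convergence. *)
  apply/cvge_at_rightP => u [u0 ucvg].
  set I := fun k => _.
  have err e dlt k : 0 <= e -> (forall y, enorm (y - x) < dlt -> `|f y - f x| <= e) ->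
      (`|I k - (f x)%:E| <= e%:E +
        (2 * M)%:E * P (Y (u k) @^-1` (~` eball 0 dlt)))%E.
    move=> e0 fe; have [_ _ YA] := Y_density _ (u0 k).
    rewrite YA; last by apply: measurableC; exact: measurable_eball.
    rewrite -dexp_indic; apply: mean_value_error => //; first exact: dpt.
    exact: continuous_measurable_rV.
  have mtail dlt k : measurable (Y (u k) @^-1` (~` eball 0 dlt)).
    have [mX _ _ _ _] := LX; have [mB _ _ _ _] := B_brownian.
    rewrite -[X in measurable X]setTI.
    by apply: (measurable_levy_sum LX B_brownian YE (ltW (u0 k))) => //;
      apply: measurableC; exact: measurable_eball.
  (* The error bound with the trivial oscillation bound [2 * M] already gives finiteness. *)
  have Ifin k : I k \is a fin_num.
    have M20 : 0 <= 2 * M by rewrite mulr_ge0.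
    have : (`|I k - (f x)%:E| < +oo)%E.
      apply: le_lt_trans (err (2 * M) 1 k M20 _) _.
        move=> y _; rewrite (le_trans (ler_normB _ _))//.
        by have := fM y; have := fM x; lra.
      by rewrite -(fineK (fin_num_measure P _ (mtail 1 k))) -EFinM -EFinD ltry.
    by case: (I k).
  apply: cvg_EFin; first exact: nearW.
  apply/cvgrPdist_le => e e0; have e20 : 0 < e / 2 by rewrite divr_gt0.
  have /cvgrPdist_le /(_ _ e20)/nbhs_normP[dlt /= dlt0 Hdlt] := cf x.
  have fe y : enorm (y - x) < dlt -> `|f y - f x| <= e / 2.
    move=> yx; rewrite distrC; apply: Hdlt => /=.
    by rewrite distrC (le_lt_trans (sup_norm_le_enorm _)).
  (* The added 1 keeps the divisor positive when [M] is 0. *)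
  have M1 : 0 < 2 * M + 1 by rewrite ltr_wpDl// mulr_ge0.
  have e2M : 0 < e / 2 / (2 * M + 1) by rewrite divr_gt0.
  have /fine_cvgP[_ /cvgrPdist_le /(_ _ e2M)] := tail_cvg0 LX B_brownian YE dlt0 u0 ucvg.
  apply: filterS => k; rewrite sub0r normrN /= => Pk.
  have := err _ _ k (ltW e20) fe.
  rewrite -(fineK (Ifin k)) -(fineK (fin_num_measure P _ (mtail dlt k))).
  rewrite -EFinM -!EFinD abse_EFin lee_fin distrC => /le_trans; apply.
  move: Pk; rewrite ger0_norm ?fine_ge0 ?measure_ge0//.
  have : 0 <= fine (P (Y (u k) @^-1` (~` eball 0 dlt))) by rewrite fine_ge0.
  set a := fine _ => a0; rewrite ler_pdivlMr// => Pk; nra.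
- split.
    (* The shift estimate needs [eta * r] strictly below [r], which 1/2 ensures. *)
    exists 2^-1; split; first by lra.
    move=> r x1 x2 r0; have r20 : 0 < 2^-1 * r by rewrite mulr_gt0// invr_gt0.
    have rr : 2^-1 * r < r by lra.
    have [C C0 HC] := gauss_smoothing_shift (x1 - x2) Hp r20 rr.
    exists C => y; rewrite -lee_fin EFinM !phiE//.
    by have := HC (x2 - y); rewrite addrC subrKA.
  move=> x r z r0; have [dr _ _ _] := Hp r r0.
  have [c c0 Hc] := gauss_smoothing_ge (enorm (x - z) + r) dr r0.
  exists c; split => // y /set_mem yz; rewrite -lee_fin phiE//; apply: Hc.
  have := ler_enorm_dist x z y; move: yz; rewrite /eball/= (enormB y z); lra.
(* The pair collects the radius and the constant of [gauss_smoothing_far] as functions of [r]; for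
   [r <= 0] it is a dummy value. *)
have /choice[GC HGC] : forall r : R, exists GC : R * R, 0 < r ->
    [/\ 0 < GC.1, 0 < GC.2 & forall t z, 0 < t < r -> GC.1 <= enorm z ->
      (gauss_smoothing t (p t) z <= GC.2%:E * gauss_smoothing (3 * r)%R (p (3 * r)%R) z)%E].
  move=> r; have [r0|r0] := ltP 0 r; last by exists (0, 0).
  have r23 : 2 * r < 3 * r by lra.
  have [G [C [G0 C0 HC]]] := gauss_smoothing_far n_gt0 Hp dg r0 r23.
  by exists (G, C).
pose K : R := (32 * n%:R) ^+ n.
have K0 : 0 <= K by rewrite exprn_ge0// mulr_ge0.
(* [gauss_smoothing_far] needs a time above [2 * r], hence 3. The factor in [2 * K] is the mass of
   the majorant [H], the doubled radius comes from [radial_majorant_maximal], and each added 2 makes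
   the value exceed 1. *)
exists 3, (fun _ _ => 2 * K + 2), (fun _ r => `|(GC r).2| + 2), (fun r => 2 * (GC r).1).
split.
- by lra.
- by move=> x t t0; split; [have := K0; lra|have := normr_ge0 (GC t).2; lra].
- move=> t A t0 _; split.
    exists (2 * K + 2); split; first exact: num_real.
    by move=> m /ltW Km y _ /=; rewrite ger0_norm// addr_ge0// mulr_ge0.
  exists (`|(GC t).2| + 2); split; first exact: num_real.
  by move=> m /ltW Km y _ /=; rewrite ger0_norm// addr_ge0.
- by move=> t t0; have [G0 _ _] := HGC t t0; rewrite mulr_gt0.
move=> r f x r0 mf f0; have [G0 C0 far] := HGC r r0.
have r30 : 0 < 3 * r by rewrite mulr_gt0.
set Mf := local_HL_maximal _ _ _.
have Mf0 : (0 <= Mf)%E by apply: local_HL_maximal_ge0; rewrite mulr_gt0.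
apply: ge_ereal_sup => _ [t /= /andP[t0 tr] <-].
have [ptt0 mptt _] := dpt _ t0; have [pt30 mpt3 _] := dpt _ r30.
have [dt rt _ _] := Hp t t0; have [p0 mp p1] := dt.
have [g0 mg g1] := dg t t0.
have mphi s : measurable_fun setT (ptilde s) ->
    measurable_fun setT (fun y => (phi s x y)%:E * f y)%E.
  move=> ms; apply: emeasurable_funM => //; apply/measurable_EFinP.
  exact: (measurableT_comp ms (measurable_rV_reflect x)).
have phif0 s y : (forall z, 0 <= ptilde s z) -> (0 <= (phi s x y)%:E * f y)%E.
  by move=> s0; rewrite mule_ge0// lee_fin; exact: s0.
(* The point [x] is a null set and is removed, since the dyadic annuli around [x] do not cover
   it. *)
rewrite (@ge0_negligible_integral _ _ _ mu setT [set x])//; last 4 first.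
- exact: measurable_set1_rV.
- exact: mphi.
- by move=> y _; exact: phif0.
- exact: lebesgue_rV_set1.
rewrite (_ : setT `\` [set x] = eball x (GC r).1 `\ x `|` ~` eball x (GC r).1); last first.
  apply/seteqP; split => [y [_ yx]|y [[_ yx]|yG]]; last 2 first.
  - by split.
  - by split => // /= yx; apply: yG; rewrite yx /eball/= subrr enorm0.
  by have [yG|yG] := pselect (eball x (GC r).1 y); [left; split|right].
have mG : measurable (eball x (GC r).1) by exact: measurable_eball.
have mGx : measurable (eball x (GC r).1 `\ x).
  by apply: measurableD => //; exact: measurable_set1_rV.
rewrite ge0_integral_setU//; last 4 first.
- exact: measurableC.
- by apply: measurable_funTS; exact: mphi.
- by move=> y _; exact: phif0.
- by apply/disj_set2P; rewrite -subset0 => y [[yG _] /(_ yG)].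
apply: leeD.
  (* A radially decreasing majorant of mass 2 for every [t]; by [gauss_smoothing_le] it dominates
     the heat kernel at points at least twice as far out. *)
  pose H z := p t z + gauss_kernel t z.
  have mH : measurable_fun setT H by exact: measurable_funD.
  have H2 : (\int[mu]_z (H z)%:E = 2%:E)%E.
    under eq_integral do rewrite EFinD.
    rewrite ge0_integralD//.
    + by rewrite p1 g1 -EFinD.
    + by move=> z _; rewrite lee_fin.
    + exact/measurable_EFinP.
    + by move=> z _; rewrite lee_fin.
    + exact/measurable_EFinP.
  apply: (le_trans (radial_majorant_maximal (H := H) x n_gt0 G0 ptt0 mptt _ mH _ _ mf f0)).
  + by move=> z; rewrite addr_ge0.
  + move=> y z y0 yz; apply: lerD; first exact: rt.
    exact: gauss_kernel_decr.
  + move=> e z e0 ez; rewrite -lee_fin phiE//.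
    exact: gauss_smoothing_le (dg t t0) _ _ _.
  rewrite -/Mf H2 muleA -EFinM; apply: lee_wpmul2r => //.
  by rewrite lee_fin -/K; lra.
have C20 : 0 <= `|(GC r).2| + 2 by rewrite addr_ge0.
rewrite -(@ge0_integralZl_EFin _ _ _ mu setT measurableT _
  (fun y _ => phif0 _ y pt30) (mphi _ mpt3) _ C20).
(* Outside the ball the kernel at time [t] is bounded pointwise by the one at time [3 * r]. *)
rewrite [leLHS]integral_mkcond; apply: ge0_le_integralT => y.
  by rewrite patchE; case: ifP => // _; exact: phif0.
rewrite patchE; case: ifPn => [/set_mem yG|_]; last first.
  by rewrite mule_ge0 ?phif0// lee_fin addr_ge0.
rewrite muleA lee_wpmul2r// -EFinM phiE//.
apply: (@le_trans _ _ ((GC r).2%:E * gauss_smoothing (3 * r)%R (p (3 * r)%R) (x - y))%E).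
  apply: far; first by rewrite t0.
  rewrite enormB leNgt; apply/negP; exact: yG.
rewrite EFinM phiE// lee_wpmul2r//.
  by rewrite -phiE// lee_fin.
by rewrite lee_fin (le_trans (ler_norm _))// lerDl.
Qed.
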